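(* Let $(W,S)$ be a finite Coxeter group, let $p$ be a prime, and let $K\in E$ and $L\in F$. Then $d_{KL}=1$ if and only if $K$ and $L$ lie in the same class of the equivalence relation on $E$ generated by $\rightarrow_p$.
   Context: For $J\subseteq S$, $W_J=\langle J\rangle$. $E$ is a set of representatives of the $W$-conjugacy classes of subsets of $S$. For $J,K\subseteq S$, $\beta_{JK}$ is the number of fixed points of $W_K$ on the coset space $W/W_J$; $M^c(W)=(\beta_{JK})_{J,K\in E}$ is the parabolic table of marks. For a prime $p$, $F\subseteq E$ is the set of $J\in E$ whose row of $M^c(W)$ is non-zero modulo $p$ (equivalently, $p\nmid [N_W(W_J):W_J]$). For $K\in E$, $L\in F$, $d_{KL}=1$ if columns $K$ and $L$ of $M^c(W)$ are equal modulo $p$, and $d_{KL}=0$ otherwise; $D=(d_{KL})$ is the decomposition matrix of the descent algebra $\Sigma_W$ modulo $p$. For a subgroup $U\le W$, its parabolic closure $U^c$ is the intersection of all parabolic subgroups of $W$ (conjugates $W_J^w$ with $J\subseteq S$, $w\in W$) containing $U$; it is a parabolic subgroup, hence conjugate to $W_K$ for some $K\in E$. For $w\in W$, $w'$ denotes the $p$-regular part of $w$: the element $w'$ in the unique factorization $w=w'w''=w''w'$ with $w'$ of order prime to $p$ and $w''$ of $p$-power order. The relation $\rightarrow_p$ on $E$ is defined by: $J\rightarrow_p K$ if $\langle w'\rangle^c$ is conjugate to $W_K$ for some $w\in W$ such that $\langle w\rangle^c$ is conjugate to $W_J$. *)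

(* Defs.v *)
From mathcomp Require Import all_boot all_fingroup all_solvable.
From Stdlib Require Import Relation_Operators.

Set Implicit Arguments.
Unset Strict Implicit.
Unset Printing Implicit Defensive.

Import GroupScope.

Section Coxeter.

Variables (gT : finGroupType) (W : {group gT}) (S : {set gT}).

(* S consists of involutions generating W, and W is presented by the relations
   (s t)^m(s,t) = 1 for s, t in S, where m(s,t) is the order of s t in W (which
   is finite here). The presentation is expressed by its universal property,
   with respect to arbitrary, possibly infinite, groups H; the case s = t
   gives the relation s^2 = 1. *)
Record coxeter_system : Prop := CoxeterSystem {
  cox_gen : <<S>> = W;
  cox_invol : forall s, s \in S -> #[s] = 2;
  cox_pres : forall (H : groupType) (f : gT -> H),
    {in S &, forall s t, (f s * f t) ^+ #[s * t] = 1} ->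
    exists2 g : gT -> H, {in W &, {morph g : x y / x * y}} & {in S, g =1 f}
}.

(* E contains exactly one subset of S from each class of subsets of S that are
   conjugate in W (as subsets of W). *)
Definition conj_representatives (E : {set {set gT}}) : bool :=
  is_transversal E
    (equivalence_partition (fun J K : {set gT} => K \in J :^: W) (powerset S))
    (powerset S).

(* W acts on the cosets of W_J = <<J>> by translation on the right. *)
Definition mark (J K : {set gT}) : nat :=
  #|'Fix_(rcosets <<J>> W | 'Rs)(<<K>>)|.

Definition nonzero_rows (p : nat) (E : {set {set gT}}) : {set {set gT}} :=
  [set J in E | [exists K in E, mark J K != 0 %[mod p]]].

Definition decomposition_number (p : nat) (E : {set {set gT}})
    (K L : {set gT}) : nat :=
  (if [forall J in E, mark J K == mark J L %[mod p]] then 1 else 0)%N.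

Definition parabolics : {set {set gT}} :=
  [set <<J>> :^ w | J in powerset S, w in W].

Definition parabolic_closure (U : {set gT}) : {set gT} :=
  \bigcap_(P in parabolics | U \subset P) P.

(* w.`_p^' is the p-regular part of w. *)
Definition parrow (p : nat) (E : {set {set gT}}) (J K : {set gT}) : Prop :=
  [/\ J \in E, K \in E
    & exists w, [/\ w \in W,
        parabolic_closure <[w]> \in <<J>> :^: W
      & parabolic_closure <[w.`_p^']> \in <<K>> :^: W]].

(* Outside E this is the identity relation, so its restriction to E is the
   equivalence relation on E generated by parrow. *)
Definition parrow_equiv (p : nat) (E : {set {set gT}}) :
    {set gT} -> {set gT} -> Prop :=
  clos_refl_sym_trans {set gT} (parrow p E).

End Coxeter.

(* Main.v *)
(** For a parabolic subgroup [W_J] let [V_J] be the span of its roots in the geometric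
representation, and [g_J w = det (1 - w | V_J)] on [N(W_J)]. If [g_J w] is nonzero, then every
parabolic subgroup containing [w] contains [W_J]; moreover the values of [g_J] on [W_J] add up to
[|W_J|], since the alternating multilinear forms on [V_J] have no invariants in positive degree.

Let [f] be an integer combination of the permutation characters on the cosets of the [W_J] and of
functions of the parabolic closure of [w] that only depend on the [p]-regular part of [w]. As [g_J]
is a virtual character, a variant of Brauer's and Frobenius' theorems shows that the sum of [f g_J]
over [N(W_J)] is divisible by the [p]-part of [|N(W_J)|]. If [f] vanishes on the elements with
closure larger than [W_J], this sum is [|W_J|] times the value of [f] at [W_J], so that this value
is divisible by the [p]-part of [[N(W_J) : W_J]], and up to a factor prime to [p] a multiple of the
[J]-th mark can be subtracted to make it vanish. Descending in this way, the indicator function of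
a class of the relation generated by [->_p] is a [p]-integral combination of marks, so its values at
two columns that agree modulo [p] agree. The converse is the congruence between the numbers of
fixed points of [w] and of its [p]-regular part. *)

From HB Require Import structures.
From Stdlib Require Import Relation_Operators.
Require Import Defs.
From mathcomp Require Import all_boot all_fingroup all_solvable.
From mathcomp Require Import all_order all_algebra all_field classfun ring.

Set Implicit Arguments.
Unset Strict Implicit.
Unset Printing Implicit Defensive.

Import Order.TTheory GRing.Theory Num.Theory.

(** * Exterior powers *)

Section ExteriorPowers.
Local Open Scope ring_scope.

(** Multiplying the same two block matrices in both orders gives block triangular matrices with
    these determinants. *)
Lemma det1_addmul (R : comNzRingType) m n (X : 'M[R]_(m, n)) (Y : 'M[R]_(n, m)) :
  \det (1%:M + X *m Y) = \det (1%:M + Y *m X).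
Proof.
have eq1 : block_mx 1%:M X (- Y) 1%:M *m block_mx 1%:M 0 Y 1%:M
    = block_mx (1%:M + X *m Y) X 0 1%:M.
  by rewrite mulmx_block !(mulmx1, mul1mx, mulmx0, add0r, addNr).
have eq2 : block_mx 1%:M 0 Y 1%:M *m block_mx 1%:M X (- Y) 1%:M
    = block_mx 1%:M X 0 (1%:M + Y *m X).
  by rewrite mulmx_block !(mulmx1, mul1mx, mul0mx, addr0, addrN) addrC.
have := congr1 determinant eq1; have := congr1 determinant eq2.
rewrite !det_mulmx !det_ublock !det_lblock !det1 !(mul1r, mulr1) => ->.
by move=> ->.
Qed.

(** The hypothesis says [B ^ (k + 1) = B], so every eigenvalue is 0 or a [k]-th root of unity. *)
Lemma mxtrace_Aint n (B : 'M[algC]_n) k :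
  (0 < k)%N -> iter k (mulmx B) B = B -> \tr B \in Aint.
Proof.
case: n B => [|n] B k0 eqB.
  by rewrite /mxtrace big_ord0 rpred0.
have [r Dp] := closed_field_poly_normal (char_poly B).
rewrite (monicP (char_poly_monic B)) scale1r in Dp.
have szr : size r = n.+1.
  by have := size_char_poly B; rewrite Dp size_prod_XsubC => -[].
have -> : \tr B = \sum_(x <- r) x.
  have : (char_poly B)`_(size r).-1 = - \tr B by rewrite szr char_poly_trace.
  by rewrite Dp coefPn_prod_XsubC ?szr // => /oppr_inj.
rewrite big_seq; apply: rpred_sum => x xr.
have /eigenvalueP[v Bv v0] : eigenvalue B x.
  by rewrite eigenvalue_root_char Dp root_prod_XsubC.
have iterE j : v *m iter j (mulmx B) B = x ^+ j.+1 *: v.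
  elim: j => [|j IHj] /=; first by rewrite expr1.
  by rewrite mulmxA Bv -scalemxAl IHj scalerA -exprS.
have := iterE k; rewrite eqB Bv => /eqP; rewrite -subr_eq0 -scalerBl.
rewrite scaler_eq0 (negPf v0) orbF subr_eq0 exprS -{1}[x]mulr1 => /eqP eqx.
have [->|x0] := eqVneq x 0; first exact: rpred0.
apply: (@Aint_unity_root k) => //; apply/unity_rootP.
by apply: (mulfI x0); rewrite -eqx.
Qed.

Variable n : nat.

Definition minor i (A : 'M[algC]_n) (f h : {ffun 'I_i -> 'I_n}) : algC :=
  \det (\matrix_(k, l) A (f k) (h l)).

(* Indexing by all functions instead of the increasing ones makes Cauchy-Binet an unrestricted
   sum; with the factor [1/i!] the map [ext_mx i] is multiplicative, but [ext_mx i 1] is only an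
   idempotent. *)
Definition ext_mx i (A : 'M[algC]_n) : 'M[algC]_#|{ffun 'I_i -> 'I_n}| :=
  \matrix_(k, l) (minor A (enum_val k) (enum_val l) / i`!%:R).

(** Cauchy-Binet: after a Leibniz expansion of [minor B g h], each of the [i!] permutations
    contributes the same amount, by multilinearity of the determinant. *)
Lemma sum_minor_mul i (A B : 'M[algC]_n) f h :
  \sum_(g : {ffun 'I_i -> 'I_n}) minor A f g * minor B g h
    = i`!%:R * minor (A *m B) f h.
Proof.
have expand (s : 'S_i) :
    \sum_(g : {ffun 'I_i -> 'I_n}) minor A f g * \prod_k B (g k) (h (s k))
      = (-1) ^+ s * minor (A *m B) f h.
  rewrite /minor.
  transitivity (\det (\matrix_(k, l) (A *m B) (f k) (h (s l)))).
    rewrite /determinant.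
    under eq_bigr do rewrite mulr_suml.
    rewrite exchange_big /=; apply: eq_bigr => t _.
    under eq_bigr do rewrite -mulrA.
    rewrite -mulr_sumr; congr (_ * _).
    transitivity (\prod_k \sum_j A (f ((t^-1)%g k)) j * B j (h (s k))).
      rewrite bigA_distr_bigA /=; apply: eq_bigr => g _.
      rewrite big_split /=; congr (_ * _).
      rewrite [RHS](reindex_inj (@perm_inj _ t)) /=.
      by apply: eq_bigr => k _; rewrite !mxE permK.
    rewrite (reindex_inj (@perm_inj _ t)) /=.
    by apply: eq_bigr => k _; rewrite !mxE permK.
  rewrite (_ : \matrix_(k, l) _ = col_perm s (\matrix_(k, l) (A *m B) (f k) (h l))).
    by rewrite col_permE det_mulmx det_perm odd_permV mulrC.
  by apply/matrixP => k l; rewrite !mxE.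
rewrite {2}/minor /determinant.
under eq_bigr do rewrite mulr_sumr.
rewrite exchange_big /=.
transitivity (\sum_(s : 'S_i) minor (A *m B) f h); last first.
  by rewrite sumr_const card_Sn mulr_natl.
apply: eq_bigr => s _.
transitivity ((-1) ^+ s * \sum_(g : {ffun 'I_i -> 'I_n})
   (minor A f g * \prod_k B (g k) (h (s k)))); last first.
  by rewrite expand mulrA -expr2 sqrr_sign mul1r.
rewrite mulr_sumr; apply: eq_bigr => g _.
rewrite mulrCA; congr (_ * _); congr (_ * _).
by apply: eq_bigr => k _; rewrite mxE.
Qed.


Lemma ext_mxM i (A B : 'M[algC]_n) : ext_mx i (A *m B) = ext_mx i A *m ext_mx i B.
Proof.
have i0 : i`!%:R != 0 :> algC by rewrite pnatr_eq0 -lt0n fact_gt0.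
apply/matrixP => k l; rewrite !mxE.
transitivity (\sum_(g : {ffun 'I_i -> 'I_n})
    (minor A (enum_val k) g * minor B g (enum_val l)) / i`!%:R / i`!%:R).
  by rewrite -!mulr_suml sum_minor_mul [_`!%:R * _]mulrC mulfK.
rewrite (reindex (@enum_val _ predT)) /=; last first.
  exists (@enum_rank _) => x _; [exact: enum_valK | exact: enum_rankK].
apply: eq_bigr => j _; rewrite !mxE.
by rewrite mulrACA -mulrA -invfM.
Qed.

(** Rows outside [I] are replaced by rows of the identity, which keeps the size equal to [n] for
    every [I]. *)
Definition principal_minor (A : 'M[algC]_n) (I : {set 'I_n}) : algC :=
  \det (\matrix_(a, b) if a \in I then A a b else (a == b)%:R).

(** With [F] the 0-1 matrix of [f], the minor is the determinant of [F^T A F = 1 + (F^T A - F^T) F],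
    and [det1_addmul] turns it into an [n] by [n] determinant. *)
Lemma minor_injective i (A : 'M[algC]_n) (f : {ffun 'I_i -> 'I_n}) :
  injective f -> minor A f f = principal_minor A [set x | x \in codom f].
Proof.
move=> injf; pose F : 'M[algC]_(n, i) := \matrix_(a, k) (a == f k)%:R.
have FtA m (B : 'M_(n, m)) k b : (F^T *m B) k b = B (f k) b.
  rewrite mxE (bigD1 (f k)) //= !mxE eqxx mul1r big1 ?addr0 // => j jk.
  by rewrite !mxE (negPf jk) mul0r.
have AF m (B : 'M_(m, n)) b k : (B *m F) b k = B b (f k).
  rewrite mxE (bigD1 (f k)) //= !mxE eqxx mulr1 big1 ?addr0 // => j jk.
  by rewrite !mxE (negPf jk) mulr0.
have FF : F^T *m F = 1%:M.
  by apply/matrixP => k l; rewrite FtA !mxE (inj_eq injf).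
have -> : minor A f f = \det (1%:M + (F^T *m A - F^T) *m F).
  congr (\det _); rewrite mulmxBl FF addrC subrK.
  by apply/matrixP => k l; rewrite AF FtA mxE.
rewrite -det1_addmul; congr (\det _); apply/matrixP => a b.
have -> : (1%:M + F *m (F^T *m A - F^T)) a b
    = (a == b)%:R + \sum_k (a == f k)%:R * (A (f k) b - (b == f k)%:R).
  rewrite !mxE; congr (_ + _); apply: eq_bigr => k _.
  by rewrite [F a k]mxE mxE FtA; congr (_ * (_ + _)); rewrite !mxE.
rewrite !mxE inE; case: codomP => [[k ->] | notf].
  rewrite (bigD1 k) //= eqxx mul1r big1 ?addr0 => [|j jk].
    by rewrite addrC eq_sym subrK.
  by rewrite (inj_eq injf) eq_sym (negPf jk) mul0r.
rewrite big1 ?addr0 // => j _.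
by have [eqa|_] := eqVneq a (f j); [case: notf; exists j | rewrite mul0r].
Qed.

Lemma det1B (A : 'M[algC]_n) :
  \det (1%:M - A) = \sum_(I : {set 'I_n}) (-1) ^+ #|I| * principal_minor A I.
Proof.
rewrite /principal_minor /determinant.
under [RHS]eq_bigr do rewrite mulr_sumr.
rewrite exchange_big /=; apply: eq_bigr => s _.
under eq_bigr do rewrite !mxE addrC.
rewrite bigA_distr mulr_sumr; apply: eq_bigr => I _.
rewrite mulrCA; congr (_ * _).
have -> : (-1) ^+ #|I| = \prod_j (if j \in I then -1 else 1) :> algC.
  by rewrite -big_mkcond /= prodr_const.
rewrite -big_split /=; apply: eq_bigr => j _; rewrite !mxE.
by case: ifP => _; rewrite ?mulN1r ?mul1r.
Qed.

(** A function that is not injective gives a minor with two equal rows, and each [i]-subset is the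
    image of [i!] injective functions. *)
Lemma sum_minor_diag i (A : 'M[algC]_n) :
  \sum_(f : {ffun 'I_i -> 'I_n}) minor A f f
    = i`!%:R * \sum_(I : {set 'I_n} | #|I| == i) principal_minor A I.
Proof.
rewrite (bigID (fun f : {ffun 'I_i -> 'I_n} => injectiveb f)) /= addrC big1 => [|f]; last first.
  move=> /injectivePn[k [l neq_kl eq_f]].
  by apply: (determinant_alternate neq_kl) => j; rewrite !mxE eq_f.
rewrite add0r (partition_big (fun f : {ffun 'I_i -> 'I_n} => [set x | x \in codom f])
   (fun I => #|I| == i)) /=; last first.
  move=> f /injectiveP injf; rewrite cardsE card_codom // card_ord.
  by rewrite eqxx.
rewrite mulr_sumr; apply: eq_bigr => I /eqP cardI.
transitivity (\sum_(f : {ffun 'I_i -> 'I_n} |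
     (f \in ffun_on (mem I)) && injectiveb f) principal_minor A I).
  apply: eq_big => [f|f /andP[/injectiveP injf /eqP <-]]; last exact: minor_injective.
  apply/andP/andP=> [[injf /eqP defI]|[/ffun_onP onI /injectiveP injf]]; split=> //.
  - by apply/ffun_onP => k; rewrite -defI inE codom_f.
  - exact/injectiveP.
  rewrite eqEcard cardsE card_codom // card_ord cardI leqnn andbT.
  by apply/subsetP => x; rewrite inE => /codomP[k ->]; apply: onI.
rewrite sumr_const mulr_natl; congr (_ *+ _).
have := card_inj_ffuns_on 'I_i (mem I).
rewrite card_ord cardI ffactnn => <-.
by rewrite cardsE; apply: eq_card => f.
Qed.

(** The right side consists of traces of exterior powers, so [det (1 - A)] is a virtual character
    when [A] is a representation. *)
Lemma det1B_ext (A : 'M[algC]_n) :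
  \det (1%:M - A) = \sum_(i < n.+1) (-1) ^+ i * \tr (ext_mx i A).
Proof.
rewrite det1B (partition_big (fun I : {set 'I_n} => inord #|I| : 'I_n.+1) predT) //=.
apply: eq_bigr => i _.
have i0 : i`!%:R != 0 :> algC by rewrite pnatr_eq0 -lt0n fact_gt0.
have cardI (I : {set 'I_n}) : ((inord #|I| : 'I_n.+1) == i) = (#|I| == i).
  by rewrite -val_eqE /= inordK // ltnS (leq_trans (max_card _)) // card_ord.
under eq_bigl do rewrite cardI.
transitivity ((-1) ^+ i * \sum_(I : {set 'I_n} | #|I| == i) principal_minor A I).
  by rewrite mulr_sumr; apply: eq_bigr => I /eqP->.
congr (_ * _); apply: (mulfI i0); rewrite -sum_minor_diag /mxtrace.
rewrite (reindex (@enum_val _ predT)) /=; last first.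
  exists (@enum_rank _) => x _; [exact: enum_valK | exact: enum_rankK].
rewrite mulr_sumr; apply: eq_bigr => j _.
by rewrite mxE mulrC divfK.
Qed.

End ExteriorPowers.

(** * Integrality of sums over the p-elements of a group *)

Section LocalIntegrality.
Local Open Scope group_scope.
Local Open Scope ring_scope.
Variables (gT : finGroupType) (p : nat).
Implicit Types (C P G N : {group gT}) (h g : gT -> algC).

Definition class_fun C h := {in C &, forall x y, h (x ^ y)%g = h x}.

(** For a virtual character the averages over [P] are multiplicities of the trivial character of
    [P]; only their integrality is retained. *)
Definition pgroup_integral C h :=
  [/\ class_fun C h, {in C, forall x, h x \in Aint}
    & forall P, P \subset C -> p.-group P -> (\sum_(z in P) h z) / #|P|%:R \in Aint].

Lemma card_afixJ (sT : finType) (to : {action gT &-> sT}) (Y : {set sT}) C x y :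
  [acts C, on Y | to] -> y \in C ->
  #|('Fix_(Y | to)[(x ^ y)%g])%g| = #|('Fix_(Y | to)[x])%g|.
Proof.
move=> actsY Cy.
rewrite -[in RHS](card_imset _ (act_inj to y)); congr #|pred_of_set _|.
apply/setP => t; apply/idP/imsetP => [|[t0]].
  rewrite !inE !sub1set !inE => /andP[Yt /eqP tx]; exists (to t (y^-1)%g); last by rewrite actKV.
  rewrite !inE !sub1set !inE (acts_act actsY) ?groupV // Yt /=; apply/eqP.
  by rewrite -!actM -{2}tx -actM; congr (to _ _); rewrite conjgE !mulgA mulgK.
rewrite !inE !sub1set !inE => /andP[Yt /eqP tx] ->.
rewrite (acts_act actsY) // Yt /=; apply/eqP.
by rewrite conjgE !actM actK tx.
Qed.

(** As in Frobenius reciprocity, the average over [P] splits into averages over point stabilisers in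
    [P], one for each [P]-orbit on [Y]. *)
Lemma pgroup_integral_fix (sT : finType) (to : {action gT &-> sT}) (Y : {set sT}) C h :
  [acts C, on Y | to] -> pgroup_integral C h ->
  pgroup_integral C (fun z => #|('Fix_(Y | to)[z])%g|%:R * h z).
Proof.
move=> actsY [hJ hA hP]; split=> [x y Cx Cy|x Cx|P sPC pP].
- by rewrite hJ // (card_afixJ _ actsY).
- by rewrite rpredM ?hA // Aint_Cnat // natr_nat.
pose s y := \sum_(z in ('C_P[y | to])%g) h z.
have -> : \sum_(z in P) #|('Fix_(Y | to)[z])%g|%:R * h z = \sum_(y in Y) s y.
  rewrite (exchange_big_dep (mem P)) /=; last by move=> y z _ /setIP[].
  apply: eq_bigr => z Pz; rewrite mulr_natl -sumr_const.
  by apply: eq_bigl => y; rewrite !inE !sub1set !inE Pz.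
pose a y := s y / #|('C_P[y | to])%g|%:R.
have aA y : a y \in Aint.
  have sCP : ('C_P[y | to] \subset P)%g by apply: subsetIl.
  by apply: hP; [apply: subset_trans sCP sPC | apply: pgroupS sCP pP].
have aJ y z : z \in P -> a (to y z) = a y.
  move=> Pz; rewrite /a /s.
  have Cz : z \in C := subsetP sPC z Pz.
  have -> : ('C_P[to y z | to] = 'C_P[y | to] :^ z)%g.
    apply/setP=> x; rewrite mem_conjg !inE groupJr ?groupV // !sub1set !inE.
    by rewrite conjgE invgK !actM -[in RHS](inj_eq (act_inj to z)) actKV.
  rewrite cardJg; congr (_ / _).
  rewrite (reindex_inj (conjg_inj z)) /=; apply: eq_big => x; first by rewrite memJ_conjg.
  by rewrite memJ_conjg => /setIP[Px _]; rewrite hJ // (subsetP sPC).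
have -> : (\sum_(y in Y) s y) / #|P|%:R = \sum_(y in Y) a y / #|orbit to P y|%:R.
  rewrite mulr_suml; apply: eq_bigr => y _.
  by rewrite -(card_orbit_stab to P y) natrM invfM /a [X in _ * X]mulrC mulrA.
rewrite (partition_big_imset (orbit to P)) /=; apply: rpred_sum => O /imsetP[y Yy ->].
rewrite (eq_bigr (fun=> a y / #|orbit to P y|%:R)) => [|t /andP[Yt /eqP tO]]; last first.
  have /orbitP[z Pz <-] : t \in orbit to P y by rewrite -tO orbit_refl.
  by rewrite aJ // (orbit_act to y Pz).
rewrite (eq_bigl (mem (orbit to P y))) => [|t]; last first.
  rewrite !inE; apply/andP/idP => [[_ /eqP <-]|]; first exact: orbit_refl.
  case/orbitP=> z Pz <-; rewrite (acts_act actsY) ?(subsetP sPC) // Yy.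
  by rewrite (orbit_act to y Pz).
rewrite sumr_const -[_ *+ _]mulr_natr divfK ?aA // pnatr_eq0 -lt0n.
by apply/card_gt0P; exists y; apply: orbit_refl.
Qed.

(* The number [psi z] of fixed points of a [p]-element [z] on the cosets of a Sylow subgroup [P] is
   prime to [p], so [psi ^ k.+1] is [1] modulo [#|P|] for [k.+1 = totient #|P|], while a sum
   weighted by [psi] splits into sums over conjugates of [P]. *)
Lemma sum_pelt_integral C h : prime p -> pgroup_integral C h ->
  (\sum_(z in C | p.-elt z) h z) / (#|C|`_p)%:R \in Aint.
Proof.
move=> p_pr hint; have [P sylP] := Sylow_exists p C.
have [sPC pP _] := and3P sylP; have cardP := card_Hall sylP.
rewrite -cardP; pose X := rcosets P C.
have actsX : [acts C, on X | 'Rs].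
  by have := actsRs_rcosets P C.
pose psi z := #|('Fix_(X | 'Rs)[z])%g|.
pose k := (totient #|P|).-1.
have k1 : k.+1 = totient #|P| by rewrite prednK // totient_gt0 cardG_gt0.
have hkint j : pgroup_integral C (fun z => (psi z ^ j)%:R * h z).
  elim: j => [|j [cj Aj Pj]].
    by case: hint => c A Pp; split=> [x y Cx Cy|x Cx|Q sQC pQ];
      rewrite ?mul1r ?c ?A //; under eq_bigr do rewrite mul1r; apply: Pp.
  have := pgroup_integral_fix actsX (And3 cj Aj Pj).
  case=> c A Pp; split=> [x y Cx Cy|x Cx|Q sQC pQ].
  - by have := c x y Cx Cy; rewrite !mulrA -!natrM -!expnS.
  - by have := A x Cx; rewrite !mulrA -!natrM -!expnS.
  - by under eq_bigr do rewrite expnS natrM -mulrA; apply: Pp.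
have psi1 z : z \in C -> p.-elt z -> (psi z ^ k.+1 = 1 %[mod #|P|])%N.
  move=> Cz pz; rewrite k1; apply: Euler_exp_totient.
  have [m ->] := p_natP pP; apply: coprimeXr.
  rewrite coprime_sym prime_coprime // /psi -afix_cycle.
  have actsz : [acts <[z]>, on X | 'Rs] by apply: subset_trans actsX; rewrite cycle_subG.
  rewrite /dvdn -(pgroup_fix_mod pz actsz) -/(dvdn _ _) -p'natE //.
  by case/and3P: sylP.
pose H z := (psi z ^ k)%:R * h z.
have sumH : (\sum_(z in C | p.-elt z) (psi z)%:R * H z) / #|P|%:R \in Aint.
  have -> : \sum_(z in C | p.-elt z) (psi z)%:R * H z
      = \sum_(x in X) \sum_(z in C | p.-elt z && (z \in 'C[x | 'Rs]%g)) H z.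
    rewrite (exchange_big_dep (fun z => (z \in C) && p.-elt z)) /=; last first.
      by move=> x z _ /and3P[-> ->].
    apply: eq_bigr => z /andP[Cz pz]; rewrite mulr_natl -sumr_const.
    by apply: eq_bigl => x; rewrite !inE !sub1set !inE Cz pz.
  rewrite mulr_suml; apply: rpred_sum => _ /rcosetsP[c Cc ->].
  rewrite (eq_bigl (mem (P :^ c)%g)) => [|z].
    have [_ _ Pint] := hkint k; rewrite -(cardJg P c).
    by apply: (Pint (P :^ c)%G); rewrite ?pgroupJ // conj_subG.
  have -> : ('C[P :* c | 'Rs] = P :^ c)%g.
    by rewrite -{2}(astab1Rs P) -astab1_act /= rcosetE.
  have sPcC : (P :^ c \subset C)%g by apply: conj_subG.
  apply/and3P/idP => [[_ _] //|Pz]; split=> //; first exact: (subsetP sPcC).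
  by apply: mem_p_elt Pz; rewrite pgroupJ.
have [_ hA _] := hint.
have P0 : #|P|%:R != 0 :> algC by rewrite pnatr_eq0 -lt0n cardG_gt0.
have qA z : z \in C -> p.-elt z -> ((psi z ^ k.+1)%:R - 1) / #|P|%:R \in Aint.
  move=> Cz pz; rewrite (divn_eq (psi z ^ k.+1) #|P|) psi1 //.
  have -> a : a - 1 = a - (1 %/ #|P| * #|P| + 1 %% #|P|)%N%:R :> algC by rewrite -divn_eq.
  rewrite !natrD [X in _ - X]addrC addrKA !natrM -mulrBl mulfK // rpredB // Aint_Cnat // natr_nat.
have -> : (\sum_(z in C | p.-elt z) h z) / #|P|%:R
   = (\sum_(z in C | p.-elt z) (psi z)%:R * H z) / #|P|%:R
     - \sum_(z in C | p.-elt z) ((psi z ^ k.+1)%:R - 1) / #|P|%:R * h z.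
  rewrite !mulr_suml -sumrB; apply: eq_bigr => z /andP[Cz pz].
  rewrite /H mulrA -natrM -expnS [X in _ - X]mulrAC -!mulrBl.
  by rewrite opprB addrC subrK mul1r.
rewrite rpredB // rpred_sum // => z /andP[Cz pz].
by rewrite rpredM ?hA ?qA.
Qed.

(** Testing only cosets [u P] with [u] a [p]-regular element centralised by [P] admits factors that
    depend on the [p]-regular part alone: they are constant on such a coset. *)
Definition locally_integral N g :=
  [/\ class_fun N g, {in N, forall x, g x \in Aint}
    & forall u P, u \in N -> p^'.-elt u -> P \subset 'C_N[u]%g -> p.-group P ->
      (\sum_(z in P) g (u * z)%g) / #|P|%:R \in Aint].

Lemma locally_integral_cent1 N g u : locally_integral N g ->
  u \in N -> p^'.-elt u -> pgroup_integral 'C_N[u] (fun z => g (u * z)%g).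
Proof.
case=> gJ gA gP Nu pu; split=> [x y|x|P sPC pP]; last exact: gP.
  case/setIP=> Nx _ /setIP[Ny /cent1P uy].
  by rewrite -(gJ (u * x)%g y) ?groupM // conjMg [(u ^ y)%g]conjgE -uy mulKg.
by case/setIP=> Nx _; rewrite gA ?groupM.
Qed.

Lemma constt_mul_commute (u z : gT) : commute u z -> p^'.-elt u -> p.-elt z ->
  ((u * z)%g.`_p^' = u)%g /\ ((u * z)%g.`_p = z)%g.
Proof.
move=> uz pu pz; rewrite !consttM // (constt_p_elt pu) (constt_p_elt pz).
have -> : (z.`_p^' = 1)%g by apply/constt1P; rewrite /p_elt pnatNK.
by have -> : (u.`_p = 1)%g; [apply/constt1P | rewrite mulg1 mul1g].
Qed.

(** The fixed points of [u * z] are those of [z] on the fixed points of [u], and ['C_N[u]] acts on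
    the latter. *)
Lemma locally_integral_fix (sT : finType) (to : {action gT &-> sT}) (Y : {set sT}) N g :
  [acts N, on Y | to] -> locally_integral N g ->
  locally_integral N (fun z => #|('Fix_(Y | to)[z])%g|%:R * g z).
Proof.
move=> actsY Ng; have [gJ gA gP] := Ng; split=> [x y Nx Ny|x Nx|u P Nu pu sPC pP].
- by rewrite gJ // (card_afixJ _ actsY).
- by rewrite rpredM ?gA // Aint_Cnat // natr_nat.
pose Y0 := ('Fix_(Y | to)[u])%g.
have actsY0 : [acts 'C_N[u], on Y0 | to].
  apply/subsetP => z /setIP[Nz /cent1P uz]; rewrite !inE /=; apply/subsetP => t.
  rewrite !inE !sub1set !inE => /andP[Yt /eqP tu].
  by rewrite (acts_act actsY) // Yt -actM uz actM tu eqxx.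
have [_ _ /(_ P sPC pP)] := pgroup_integral_fix actsY0 (locally_integral_cent1 Ng Nu pu).
rewrite -/Y0 (eq_bigr (fun z => #|('Fix_(Y | to)[u * z])%g|%:R * g (u * z)%g)) // => z Pz.
congr (_%:R * _).
have /setIP[_ /cent1P zu] := subsetP sPC z Pz.
have [du dz] := constt_mul_commute (esym zu) pu (mem_p_elt pP Pz).
apply: eq_card => t; rewrite !inE !sub1set !inE -andbA; congr (_ && _).
apply/andP/eqP=> [[/eqP tu /eqP tz]|tuz]; first by rewrite actM tu tz.
have tX x : x \in <[(u * z)%g]>%g -> to t x == t.
  have : t \in 'Fix_to(<[(u * z)%g]>)%g by rewrite afix_cycle; apply/afix1P.
  by move/afixP=> fixt /fixt/eqP.
by rewrite -{1}du -{2}dz !tX ?cycle_constt.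
Qed.

(** Sort the elements by their [p]-regular part: the class of [u] contributes its length times a sum
    over the [p]-elements of ['C_N[u]], to which [sum_pelt_integral] applies. *)
Lemma sum_locally_integral N g : prime p -> locally_integral N g ->
  (\sum_(x in N) g x) / (#|N|`_p)%:R \in Aint.
Proof.
move=> p_pr Ng; have [gJ gA gP] := Ng.
pose T u := \sum_(z in 'C_N[u] | p.-elt z) g (u * z)%g.
have -> : \sum_(x in N) g x = \sum_(u in N) if p^'.-elt u then T u else 0.
  rewrite -big_mkcondr /=.
  rewrite (partition_big (fun x => x.`_p^') (fun u => (u \in N) && p^'.-elt u)) /=; last first.
    by move=> x Nx; rewrite p_elt_constt groupX.
  apply: eq_bigr => u /andP[Nu pu]; rewrite (reindex_inj (mulgI u)) /=.
  apply: eq_bigl => z; rewrite groupMl //.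
  apply/andP/andP=> [[Nz /eqP du]|[/setIP[Nz /cent1P zu] pz]]; last first.
    by have [-> _] := constt_mul_commute (esym zu) pu pz.
  set x := (u * z)%g in Nz du *.
  have cx : commute x.`_p x.`_p^'.
    by apply: (centsP (cycle_abelian x)); apply: cycle_constt.
  have dz : z = (x.`_p)%g.
    by apply: (mulgI u); rewrite -[in RHS]du -cx consttC.
  rewrite inE Nz /=; split; last by rewrite dz p_elt_constt.
  by apply/cent1P; rewrite dz -du.
rewrite sum_by_classes => [|u y Nu Ny]; last first.
  rewrite /p_elt orderJ; case: ifP => // _; rewrite /T.
  have eqC : ('C_N[u ^ y] = 'C_N[u] :^ y)%g.
    by rewrite conjIg conjGid // cent1J.
  rewrite (reindex_inj (conjg_inj y)) eqC /=; apply: eq_big => z.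
    by rewrite memJ_conjg /p_elt orderJ.
  by rewrite memJ_conjg => /andP[/setIP[Nz _] _]; rewrite -conjMg gJ ?groupM.
rewrite mulr_suml; apply: rpred_sum => _ /imsetP[u0 Nu0 ->].
have [u Nu ->] := repr_class N u0; set v := (u0 ^ u)%g.
have Nv : v \in N by rewrite groupJ.
case: ifP => pv; last by rewrite mulr0 mul0r rpred0.
have -> : #|u0 ^: N|%g = #|N : 'C_N[v]|%g by rewrite index_cent1 classGidl.
have TA : T v / (#|'C_N[v]%G|`_p)%:R \in Aint.
  exact: sum_pelt_integral (locally_integral_cent1 Ng Nv pv).
rewrite -(Lagrange (subsetIl N 'C[v])) partnM // natrM invfM [_^-1 * _]mulrC.
rewrite mulrACA rpredM // ?TA //.
rewrite -{1}(partnC p (indexg_gt0 N 'C_N[v])) natrM mulrAC mulfV ?mul1r.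
  by rewrite Aint_Cnat // natr_nat.
by rewrite pnatr_eq0 -lt0n part_gt0.
Qed.

End LocalIntegrality.

(** * Averages of matrices over subgroups and integrality of their traces *)

Section Averages.
Local Open Scope group_scope.
Local Open Scope ring_scope.
Variables (gT : finGroupType) (N : {group gT}) (n : nat) (A : gT -> 'M[algC]_n).
Hypothesis AM : {in N &, {morph A : x y / (x * y)%g >-> x *m y}}.
Implicit Types P : {group gT}.

Definition avg_mx (P : {set gT}) := (#|P|%:R)^-1 *: \sum_(z in P) A z.

Lemma avg_mxl P z : P \subset N -> z \in P -> A z *m avg_mx P = avg_mx P.
Proof.
move=> sPN Pz; rewrite -scalemxAr mulmx_sumr; congr (_ *: _).
rewrite [RHS](reindex_inj (mulgI z)) /=; apply: eq_big => [x|x Px].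
  by rewrite groupMl.
by rewrite AM ?(subsetP sPN).
Qed.

Lemma avg_mxr P z : P \subset N -> z \in P -> avg_mx P *m A z = avg_mx P.
Proof.
move=> sPN Pz; rewrite -scalemxAl mulmx_suml; congr (_ *: _).
rewrite [RHS](reindex_inj (mulIg z)) /=; apply: eq_big => [x|x Px].
  by rewrite groupMr.
by rewrite AM ?(subsetP sPN).
Qed.

Lemma avg_mx_idem P : P \subset N -> avg_mx P *m avg_mx P = avg_mx P.
Proof.
move=> sPN; rewrite -{1}scalemxAl mulmx_suml.
rewrite (eq_bigr (fun=> avg_mx P)) => [|z Pz]; last exact: avg_mxl.
rewrite sumr_const -scaler_nat scalerA mulVf ?scale1r //.
by rewrite pnatr_eq0 -lt0n cardG_gt0.
Qed.

Lemma avg_mxC P y : P \subset N -> y \in 'N_N(P)%g -> A y *m avg_mx P = avg_mx P *m A y.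
Proof.
move=> sPN /setIP[Ny nPy]; rewrite -scalemxAl -scalemxAr mulmx_suml mulmx_sumr.
congr (_ *: _); rewrite [LHS](reindex_inj (conjg_inj y)) /=.
apply: eq_big => [x|x]; first by rewrite memJ_norm.
rewrite memJ_norm // => Px; have Nx := subsetP sPN x Px.
by rewrite -!AM ?groupJ // conjgE mulKVg.
Qed.

Lemma det1B_avgJ x y : x \in N -> y \in N ->
  \det (1%:M - A (x ^ y)%g) = \det (1%:M - A x).
Proof.
move=> Nx Ny; rewrite conjgE AM ?AM ?groupV ?groupM // -mulNmx det1_addmul.
by rewrite mulmxN -mulmxA -!AM ?groupV ?groupM // ?mulgV ?mulg1 // groupV.
Qed.

End Averages.

Section MatrixRepIntegral.
Local Open Scope group_scope.
Local Open Scope ring_scope.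
Variables (gT : finGroupType) (N : {group gT}) (n : nat) (A : gT -> 'M[algC]_n).
Hypothesis AM : {in N &, {morph A : x y / (x * y)%g >-> x *m y}}.

(** The average is the trace of [A u] times the idempotent [avg_mx A P]. These commute, so the
    powers of the product repeat with period [#[u]]. *)
Lemma avg_trace_Aint u (P : {group gT}) : u \in N -> P \subset 'C_N[u]%g ->
  (\sum_(z in P) \tr (A (u * z)%g)) / #|P|%:R \in Aint.
Proof.
move=> Nu /subsetIP[sPN cPu]; pose B := A u *m avg_mx A P.
have -> : (\sum_(z in P) \tr (A (u * z)%g)) / #|P|%:R = \tr B.
  rewrite /B -scalemxAr mxtraceZ mulrC mulmx_sumr raddf_sum; congr (_ * _).
  by apply: eq_bigr => z Pz; rewrite /= AM // (subsetP sPN).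
have nuP : u \in 'N_N(P)%g.
  rewrite inE Nu; apply: (subsetP (cent_sub P)).
  by apply/centP => z Pz; apply/esym/cent1P; apply: (subsetP cPu).
apply: (@mxtrace_Aint _ _ #[u]); first exact: order_gt0.
have iterB j : iter j (mulmx B) B = A (u ^+ j.+1)%g *m avg_mx A P.
  elim: j => [|j IHj] /=; first by rewrite expg1.
  rewrite IHj {1}/B -mulmxA (mulmxA (avg_mx A P)) -(avg_mxC AM sPN); last first.
    by rewrite groupX.
  by rewrite -(mulmxA _ (avg_mx A P)) (avg_mx_idem AM sPN) mulmxA -AM ?groupX // -expgS.
by rewrite iterB expgS expg_order mulg1.
Qed.

End MatrixRepIntegral.

Lemma locally_integral_det1B (gT : finGroupType) (N : {group gT}) n
    (A : gT -> 'M[algC]_n) p :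
  {in N &, {morph A : x y / (x * y)%g >-> (x *m y)%R}} ->
  locally_integral p N (fun x => \det (1%:M - A x))%R.
Proof.
move=> AM.
have sumA u (P : {group gT}) : u \in N -> (P \subset 'C_N[u])%g ->
    ((\sum_(z in P) \det (1%:M - A (u * z)%g)) / #|P|%:R)%R \in Aint.
  move=> Nu sPC; under eq_bigr do rewrite det1B_ext.
  rewrite exchange_big mulr_suml rpred_sum //= => i _.
  rewrite -mulr_sumr -mulrA rpredM ?rpredX ?rpredN ?rpred1 //.
  by apply: (@avg_trace_Aint _ N _ (fun x => ext_mx i (A x))) => // x y Nx Ny /=;
    rewrite AM // ext_mxM.
split=> [x y|x Nx|u P Nu _ sPC _]; last exact: sumA.
  exact: det1B_avgJ.
have := sumA x 1%G Nx (sub1G _).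
by rewrite big_set1 cards1 divr1 mulg1.
Qed.

(** * Cosines of the angles pi/m *)

Lemma real_arg_max (T : finType) (P : pred T) (F : T -> algC) x0 : P x0 ->
  (forall x, P x -> F x \is Num.real) ->
  exists2 x, P x & forall y, P y -> (F y <= F x)%R.
Proof.
move=> Px0 realF.
have cmpF : {in P &, forall x y, F x >=< F y}%R.
  by move=> x y Px Py; apply: real_comparable; apply: realF.
by case: (comparable_arg_maxP Px0 cmpF) => x Px maxx; exists x.
Qed.

Section Cosines.
Local Open Scope ring_scope.
Variable m : nat.
Hypothesis m_gt1 : (1 < m)%N.

Lemma normC_unity_root n (z : algC) : (0 < n)%N -> z ^+ n = 1 -> `|z| = 1.
Proof.
move=> n0 zn; apply/eqP; rewrite -(pexpr_eq1 n0) ?normr_ge0 //.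
by rewrite -normrX zn normr1.
Qed.

(* sin(b - a) (1 - cos(a + b)) = (cos a - cos b) (sin a + sin b), with a, b the arguments of z, y *)
Lemma Im_mul_conj_gt0 (y z : algC) : `|y| = 1 -> `|z| = 1 ->
  0 < 'Im y -> 0 < 'Im z -> 'Re y <= 'Re z -> y != z -> 0 < 'Im (y * z^*).
Proof.
move=> y1 z1 y0 z0 le_yz neq_yz.
have eqN x : `|x| = 1 -> 'Re x ^+ 2 + 'Im x ^+ 2 = 1 :> algC.
  by move=> x1; rewrite -normC2_Re_Im x1 expr1n.
have ey := eqN _ y1; have ez := eqN _ z1.
have lt_yz : 'Re y < 'Re z.
  rewrite lt_neqAle le_yz andbT; apply: contra_neq neq_yz => eqR.
  rewrite [y]Crect [z]Crect eqR; congr (_ + 'i * _).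
  move: ey; rewrite eqR -ez => /addrI/eqP; rewrite eqf_sqr => /orP[/eqP //|/eqP eqI].
  by move: y0; rewrite eqI oppr_gt0 (lt_gtF z0).
have yz1 : `|y * z| = 1 by rewrite normrM y1 z1 mulr1.
have h1 : 0 <= 1 - 'Re (y * z).
  by rewrite subr_ge0 -yz1; case: (leif_Re_Creal (y * z)).
have key : ('Re z - 'Re y) * ('Im y + 'Im z) = (1 - 'Re (y * z)) * 'Im (y * z^* ).
  rewrite ReM ImM Re_conj Im_conj.
  transitivity ('Re z * 'Im y - 'Re y * 'Im z
    - ('Re y * 'Im y * ('Re z ^+ 2 + 'Im z ^+ 2) - 'Re z * 'Im z * ('Re y ^+ 2 + 'Im y ^+ 2))).
    by rewrite ey ez; ring.
  by ring.
have pos : 0 < (1 - 'Re (y * z)) * 'Im (y * z^* ).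
  by rewrite -key; apply: mulr_gt0; rewrite ?subr_gt0 ?addr_gt0.
have h2 : 0 < 1 - 'Re (y * z).
  by rewrite lt_neqAle h1 andbT eq_sym; apply: contraTneq pos => ->; rewrite mul0r ltxx.
by rewrite -(pmulr_rgt0 _ h2).
Qed.

(* Take [z] with the largest real part among the [2m]-th roots of unity in the upper half plane:
   dividing another one by [z] stays in the upper half plane until [z] itself is reached. *)
Lemma upper_unity_root : exists2 z : algC, z ^+ m = -1 &
  forall k, (0 < k < m)%N -> 0 < 'Im (z ^+ k).
Proof.
pose n := (2 * m)%N; have n_gt0 : (0 < n)%N by rewrite muln_gt0 /= ltnW.
have [z0 prim_z0] := C_prim_root_exists n_gt0.
have n_gt2 : (2 < n)%N by rewrite (@leq_trans (2 * 2)) // leq_mul2l.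
have z0n : z0 ^+ n = 1 := prim_expr_order prim_z0.
have [y prim_y y_gt0] : exists2 y : algC, n.-primitive_root y & 0 < 'Im y.
  have : 'Im z0 != 0.
    apply: contraTneq n_gt2 => /eqP; rewrite -/(pred1 _ _) => /eqP/Creal_ImP z0r.
    rewrite -leqNgt; apply: dvdn_leq => //; rewrite (prim_order_dvd prim_z0).
    by rewrite -(real_normK z0r) (normC_unity_root n_gt0 z0n) expr1n.
  rewrite real_neqr_lt ?Creal_Im // => /orP[lt0|]; last by exists z0.
  exists z0^* ; last by rewrite Im_conj oppr_gt0.
  by rewrite fmorph_primitive_root.
have yn : y ^+ n = 1 := prim_expr_order prim_y.
have [i Ii maxi] := @real_arg_max 'I_n (fun i => 0 < 'Im (y ^+ i)) (fun i => 'Re (y ^+ i))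
  (Ordinal (ltnW n_gt2)) y_gt0 (fun i _ => Creal_Re _).
pose z := y ^+ i; have zn : z ^+ n = 1 by rewrite exprAC yn expr1n.
have z1 : `|z| = 1 := normC_unity_root n_gt0 zn.
have maxz x : x ^+ n = 1 -> 0 < 'Im x -> 'Re x <= 'Re z.
  move=> xn; have [j ->] := prim_rootP prim_y xn; exact: maxi.
have step x : x ^+ n = 1 -> 0 < 'Im x -> x != z -> 0 < 'Im (x * z^* ).
  move=> xn x0; apply: Im_mul_conj_gt0 => //; last exact: maxz.
  exact: normC_unity_root xn.
have zV : z * z^* = 1 by rewrite -normCK z1 expr1n.
have zVj j : z ^+ j * z^* ^+ j = 1 by rewrite -exprMn zV expr1n.
have zVn : z^* ^+ n = 1 by rewrite -rmorphXn zn rmorph1.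
(* Otherwise all [y / z ^ j] would stay in the upper half plane, although for [j < n] they form a
   geometric sum equal to 0. *)
have [k yz] : exists k, y = z ^+ k.
  have [/existsP[k /eqP]|] := boolP [exists k : 'I_n.+1, y == z ^+ k]; first by exists k.
  rewrite negb_exists => /forallP neqy.
  have pos j : (j <= n)%N -> 0 < 'Im (y * z^* ^+ j).
    elim: j => [|j IHj] lejn; first by rewrite mulr1.
    rewrite exprSr mulrA; apply: step; last 1 first.
    - apply: contra (neqy (Ordinal (lejn : (j.+1 < n.+1)%N))) => /eqP eqz.
      by rewrite exprSr -[X in _ == _ * X]eqz mulrCA zVj mulr1.
    - by rewrite exprMn yn mul1r exprAC zVn expr1n.
    by apply: IHj; apply: ltnW.
  have : 'Im (\sum_(j < n) y * z^* ^+ j) = 0.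
    rewrite -mulr_sumr; suff -> : \sum_(j < n) z^* ^+ j = 0 by rewrite mulr0 raddf0.
    have : z^* - 1 != 0.
      apply: contraTneq Ii => /eqP; rewrite subr_eq0 => /eqP zc.
      by rewrite -/z -[z]conjCK zc rmorph1 (Creal_ImP _ _) ?rpred1 ?ltxx.
    move/mulfI => inj; apply: inj; rewrite -subrX1 zVn subrr mulr0.
    by [].
  rewrite raddf_sum /= => /eqP; rewrite psumr_eq0 => [/allP /(_ (Ordinal n_gt0))|j _].
    by rewrite mem_index_enum => /(_ isT); rewrite /= mulr1 gt_eqF.
  by rewrite ltW // pos // ltnW.
have prim_z : n.-primitive_root z.
  have [d prim_d dvd_d] := prim_order_exists n_gt0 zn.
  suff -> : n = d by [].
  apply/eqP; rewrite eqn_dvd dvd_d andbT (prim_order_dvd prim_y) yz.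
  by rewrite exprAC (prim_expr_order prim_d) expr1n.
have zm : z ^+ m = -1.
  have /eqP := zn; rewrite /n mulnC exprM sqrf_eq1 => /orP[|/eqP //].
  rewrite -(prim_order_dvd prim_z) => /(dvdn_leq (ltnW m_gt1)).
  by rewrite leqNgt ltn_Pmull // ltnW.
exists z => //.
have negn (x : algC) : (- x) ^+ n = x ^+ n by rewrite /n !exprM sqrrN.
(* The negated conjugate of [z ^ j] has the imaginary part of [z ^ j], and dividing it by [z] leads
   from [j] to [j + 1]; so [step] drives the induction. *)
have Imx j : 'Im (- z^* ^+ j) = 'Im (z ^+ j) by rewrite raddfN /= -rmorphXn Im_conj opprK.
elim=> // {k yz}k IHk /andP[_ ltkm].
have [->|k0] := posnP k; first exact: Ii.
have {IHk} := IHk; rewrite k0 ltnW // => /(_ isT) IHk.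
have neq : - z^* ^+ k != z.
  apply: contraL ltkm => /eqP eqz; rewrite -leqNgt dvdn_leq //.
  have zk : z ^+ k.+1 = -1 by rewrite exprSr -[X in _ * X]eqz mulrN zVj.
  have z2 : z ^+ (2 * k.+1) = 1 by rewrite mulnC exprM zk sqrrN expr1n.
  have /eqP := z2.
  by rewrite -(prim_order_dvd prim_z) /n dvdn_pmul2l.
rewrite -Imx exprSr -mulNr; apply: step => //; last by rewrite Imx.
by rewrite negn exprAC zVn expr1n.
Qed.

(** Here [c = 2 cos (pi/m)] and [u k = sin (k pi/m) / sin (pi/m)]. The condition on [c ^+ 2] makes
    the Cartan matrix of rank two invertible. *)
Lemma dihedral_sines : exists c (u : nat -> algC),
  [/\ c \is Num.real, c ^+ 2 != 4,
      [/\ u 0%N = 0, u 1%N = 1 & forall k, u k.+2 = c * u k.+1 - u k],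
      forall k, (k <= m)%N -> 0 <= u k
    & forall k, u (m + k)%N = - u k].
Proof.
have [z zm Iz] := upper_unity_root.
have z1 : `|z| = 1.
  apply: (@normC_unity_root (m * 2)); first by rewrite muln_gt0 ltnW.
  by rewrite exprM zm sqrrN expr1n.
have zV : z * z^* = 1 by rewrite -normCK z1 expr1n.
have I0 : 0 < 'Im z by rewrite -[z]expr1 Iz.
have I_neq0 : 'Im z != 0 by rewrite gt_eqF.
have RI : 'Re z ^+ 2 + 'Im z ^+ 2 = 1 by rewrite -normC2_Re_Im z1 expr1n.
have Rz : 2 * 'Re z = z + z^* by rewrite ReE mulrC divfK ?pnatr_eq0.
exists (2 * 'Re z), (fun k => 'Im (z ^+ k) / 'Im z); split.
- by rewrite rpredM ?Creal_Re ?rpred_nat.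
- have RE : 'Re z ^+ 2 = 1 - 'Im z ^+ 2 by rewrite -RI addrK.
  rewrite exprMn -subr_eq0 RE.
  rewrite (_ : _ - _ = - (4 * 'Im z ^+ 2)); last by ring.
  by rewrite oppr_eq0 mulf_neq0 ?expf_neq0 ?pnatr_eq0.
- split; first by rewrite expr0 (Creal_ImP _ _) ?rpred1 ?mul0r.
    by rewrite expr1 divff.
  move=> k; rewrite mulrA -mulrBl; congr (_ / _).
  rewrite -ImMl ?rpredM ?Creal_Re ?rpred_nat // -raddfB /= Rz; congr ('Im _).
  have zk : z^* * z ^+ k.+1 = z ^+ k by rewrite exprS mulrA [z^* * z]mulrC zV mul1r.
  by rewrite mulrDl zk -exprS addrK.
- move=> k; rewrite leq_eqVlt => /orP[/eqP->|ltkm].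
    by rewrite zm raddfN /= (Creal_ImP _ _) ?rpred1 ?oppr0 ?mul0r.
  have [->|k0] := posnP k; first by rewrite expr0 (Creal_ImP _ _) ?rpred1 ?mul0r.
  by rewrite divr_ge0 ?ltW // Iz ?k0.
by move=> k; rewrite exprD zm mulN1r raddfN /= mulNr.
Qed.

End Cosines.

(** * Words in the generators *)

Section WordLength.
Local Open Scope group_scope.
Variables (gT : finGroupType) (S : {set gT}).

(** [(1 |: S) ^+ n] holds the products of at most [n] generators; the search ends at an exponent
    giving all of [<<S>>], and elements outside [<<S>>] get a default value. *)
Definition word_length (w : gT) : nat :=
  find (fun n => w \in (1 |: S) ^+ n) (iota 0 (sval (gen_expgs S)).+1).

Lemma expgs_mono m n : (m <= n)%N -> (1 |: S) ^+ m \subset (1 |: S) ^+ n.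
Proof.
move=> /subnKC <-; elim: (n - m)%N => [|k IHk]; first by rewrite addn0.
apply: subset_trans IHk _; rewrite addnS expgSr.
by rewrite -{1}[_ ^+ _]mulg1 mulgS // sub1set !inE eqxx.
Qed.

Lemma word_length_le w n : w \in <<S>> -> (word_length w <= n)%N = (w \in (1 |: S) ^+ n).
Proof.
move=> Ww; pose n0 := sval (gen_expgs S).
have has_w : has (fun n => w \in (1 |: S) ^+ n) (iota 0 n0.+1).
  apply/hasP; exists n0; first by rewrite mem_iota /= ltnSn.
  by rewrite -(svalP (gen_expgs S)).
have len_lt : (word_length w < n0.+1)%N by move: has_w; rewrite has_find size_iota.
have in_len : w \in (1 |: S) ^+ word_length w.
  by have := nth_find 0%N has_w; rewrite nth_iota.
apply/idP/idP => [le_n|win]; first exact: (subsetP (expgs_mono le_n)).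
rewrite leqNgt; apply/negP => lt_n.
have := before_find 0%N lt_n; rewrite nth_iota ?add0n ?win //.
exact: ltn_trans lt_n len_lt.
Qed.

Lemma word_lengthM x y : x \in <<S>> -> y \in <<S>> ->
  (word_length (x * y) <= word_length x + word_length y)%N.
Proof.
by move=> Wx Wy; rewrite word_length_le ?groupM // expgD mem_mulg // -word_length_le.
Qed.

Lemma word_length0 w : w \in <<S>> -> word_length w = 0%N -> w = 1.
Proof.
move=> Ww l0; have := word_length_le 0 Ww.
by rewrite l0 leqnn expg0 => /esym/set1P.
Qed.

Lemma word_length_gen s : s \in S -> (word_length s <= 1)%N.
Proof. by move=> Ss; rewrite word_length_le ?mem_gen // expg1 !inE Ss orbT. Qed.

Hypothesis invol : forall s, s \in S -> #[s] = 2.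

Lemma gen_mulgg s : s \in S -> s * s = 1.
Proof. by move=> Ss; rewrite -expg2 -(invol Ss) expg_order. Qed.

Lemma word_length_descent w : w \in <<S>> -> (0 < word_length w)%N ->
  exists2 s, s \in S & (word_length (w * s)).+1 = word_length w.
Proof.
move=> Ww; case dl: (word_length w) => [//|n] _.
have : w \in (1 |: S) ^+ n.+1 by rewrite -word_length_le // dl.
rewrite expgSr => /mulsgP[v s vn]; rewrite !inE => /orP[/eqP-> dw|Ss dw].
  by have := word_length_le n Ww; rewrite dl ltnn dw mulg1 vn.
have dv : w * s = v by rewrite dw -mulgA gen_mulgg ?mulg1.
exists s => //; congr _.+1; apply/eqP; rewrite eqn_leq dv.
have Wv : v \in <<S>> by rewrite -dv groupM // mem_gen.
rewrite word_length_le // vn /= -ltnS -dl dw.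
apply: leq_trans (word_lengthM Wv (mem_gen Ss)) _.
by rewrite -addn1 leq_add2l word_length_gen.
Qed.

Lemma gen_invg s : s \in S -> s^-1 = s.
Proof. by move=> Ss; apply/eqP; rewrite eq_invg_mul gen_mulgg. Qed.

Lemma word_length_step w s : w \in <<S>> -> s \in S ->
  (word_length w <= (word_length (w * s)).+1)%N.
Proof.
move=> Ww Ss; have Wws : w * s \in <<S>> by rewrite groupM // mem_gen.
have {1}-> : w = w * s * s by rewrite -mulgA gen_mulgg ?mulg1.
apply: leq_trans (word_lengthM Wws (mem_gen Ss)) _.
by rewrite -[X in (_ <= X)%N]addn1 leq_add2l word_length_gen.
Qed.

(** The word grows to the left: for [k > 0] its last letter is [t], and its first letter depends on
    the parity of [k]. *)
Fixpoint alternating (s t : gT) (k : nat) : gT :=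
  if k is k'.+1 then (if odd k' then s else t) * alternating s t k' else 1.

Lemma alternating_gen s t k : s \in S -> t \in S -> alternating s t k \in <<S>>.
Proof.
move=> Ss St; elim: k => [|k IHk] /=; first exact: group1.
by apply: groupM => //; case: ifP => _; apply: mem_gen.
Qed.

Lemma word_length_alternating s t k : s \in S -> t \in S ->
  (word_length (alternating s t k) <= k)%N.
Proof.
move=> Ss St; rewrite word_length_le ?alternating_gen //.
elim: k => [|k IHk] /=; first by rewrite inE.
by rewrite expgS mem_mulg // !inE; case: odd; rewrite ?Ss ?St ?orbT.
Qed.

Lemma alternating_double s t k : alternating s t k.*2 = (s * t) ^+ k.
Proof.
elim: k => // k IHk; rewrite doubleS /= odd_double /= IHk mulgA.
by rewrite -expgS.
Qed.

Lemma alternatingSr s t k : alternating s t k.+1 = alternating t s k * t.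
Proof.
elim: k => [|k IHk] /=; first by rewrite mulg1 mul1g.
by move: IHk => /= ->; rewrite mulgA; case: (odd k).
Qed.

Lemma alternatingD s t j k :
  alternating s t (j + k) = (if odd k then alternating t s j else alternating s t j) * alternating s t k.
Proof.
elim: j => [|j IHj]; first by rewrite add0n; case: odd; rewrite /= mul1g.
by rewrite addSn /= IHj oddD; case: (odd k); case: (odd j); rewrite /= !mulgA.
Qed.

Lemma alternatingV s t k : s \in S -> t \in S ->
  (alternating s t k)^-1 = if odd k then alternating s t k else alternating t s k.
Proof.
move=> Ss St; elim: k => [|k IHk]; first by rewrite /= invg1.
rewrite [in LHS]/= invMg IHk [odd _]/=; case: ifP => /= odd_k.
  by rewrite gen_invg // -alternatingSr /= odd_k.
by rewrite gen_invg // -alternatingSr /= odd_k.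
Qed.

(** The alternating word of length [2 m] is [(s t) ^ m = 1], so its two halves are inverse to each
    other, and inversion reverses a word. *)
Lemma alternating_braid s t : s \in S -> t \in S ->
  alternating s t #[s * t] = alternating t s #[s * t].
Proof.
move=> Ss St; set m := #[s * t].
have : alternating s t (m + m) = 1 by rewrite addnn alternating_double expg_order.
rewrite alternatingD => /eqP; rewrite -eq_invg_mul.
by case: ifP => odd_m; rewrite alternatingV // odd_m => /eqP->.
Qed.

End WordLength.

(** * Positivity of roots and stabilisers of weights *)

(* [al], [be] and [om] are the simple roots, the simple coroots and a family of linear forms dual to
   the simple roots. *)
Record root_basis (gT : finGroupType) (S : {set gT}) (n : nat) (rho : gT -> 'M[algC]_n)
    (al : gT -> 'cV[algC]_n) (be om : gT -> 'rV[algC]_n) : Prop := RootBasis {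
  rho_mul : {in <<S>>%g &, {morph rho : x y / (x * y)%g >-> (x *m y)%R}};
  rho_one : rho 1%g = 1%:M%R;
  rho_gen : {in S, forall s, rho s = (1%:M - al s *m be s)%R};
  coroot_root : {in S, forall s, be s *m al s = 2%:M}%R;
  dual_root : {in S &, forall r s, om r *m al s = (r == s)%:R%:M}%R;
  rho_alternating : {in S &, forall s t, s != t -> forall k, (k < #[s * t]%g)%N ->
    exists x y, [/\ 0 <= x, 0 <= y
      & rho (alternating s t k) *m al s = x *: al s + y *: al t]}%R
}.

Section RootPositivity.
Local Open Scope group_scope.
Local Open Scope ring_scope.
Variables (gT : finGroupType) (S : {set gT}) (n : nat) (rho : gT -> 'M[algC]_n).
Variables (al : gT -> 'cV[algC]_n) (be om : gT -> 'rV[algC]_n).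
Hypothesis invol : forall s, s \in S -> #[s]%g = 2%N.
Hypothesis rb : root_basis S rho al be om.

Local Notation len := (word_length S).
Local Notation W := <<S>>%g.

Definition nonneg_root_comb (v : 'cV[algC]_n) := exists2 c : gT -> algC,
  forall r, 0 <= c r & v = \sum_(r in S) c r *: al r.

Lemma nonneg_root s : s \in S -> nonneg_root_comb (al s).
Proof.
move=> Ss; exists (fun r => (r == s)%:R) => [r|]; first exact: ler0n.
rewrite (bigD1 s) //= eqxx scale1r big1 ?addr0 // => r /andP[_ /negPf->].
by rewrite scale0r.
Qed.

Lemma nonneg_root_comb0 : nonneg_root_comb 0.
Proof. by exists (fun=> 0) => //; rewrite big1 // => r _; exact: scale0r. Qed.

Lemma nonneg_root_combD v w :
  nonneg_root_comb v -> nonneg_root_comb w -> nonneg_root_comb (v + w).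
Proof.
move=> [c c0 ->] [d d0 ->]; exists (fun r => c r + d r) => [r|]; first exact: addr_ge0.
by rewrite -big_split; apply: eq_bigr => r _; rewrite scalerDl.
Qed.

Lemma nonneg_root_combZ a v : 0 <= a -> nonneg_root_comb v -> nonneg_root_comb (a *: v).
Proof.
move=> a0 [c c0 ->]; exists (fun r => a * c r) => [r|]; first exact: mulr_ge0.
by rewrite scaler_sumr; apply: eq_bigr => r _; rewrite scalerA.
Qed.

Lemma rho_gen_root s : s \in S -> rho s *m al s = - al s.
Proof.
move=> Ss; rewrite (rho_gen rb) // mulmxBl mul1mx -mulmxA (coroot_root rb) //.
by rewrite mul_mx_scalar scaler_nat mulr2n opprD addrA subrr sub0r.
Qed.

(* Write [w = v a] with [a] an alternating word in [s] and [t] ending in [t], of the greatest length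
   [k <= m] such that the lengths of [v] and [a] add up to that of [w]: then [v] maps both [al s]
   and [al t] to nonnegative combinations, and [k < m]. *)
Lemma nonneg_rho_root w s : w \in W -> s \in S -> (len w <= len (w * s)%g)%N ->
  nonneg_root_comb (rho w *m al s).
Proof.
have [N] := ubnP (len w); elim: N w s => // N IHN w s /ltnSE-leN Ww Ss le_ws.
have [/eqP l0|l0] := posnP (len w).
  by rewrite (word_length0 Ww (eqP l0)) (rho_one rb) mul1mx; apply: nonneg_root.
have [t St lt_t] := word_length_descent invol Ww l0.
have neq_st : s != t by apply: contraTneq le_ws => ->; rewrite -ltnNge -lt_t ltnS.
set m := #[(s * t)%g].
have m1 : (1 < m)%N.
  rewrite ltn_neqAle order_gt0 eq_sym order_eq1 andbT -eq_invg_mul.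
  apply: contra neq_st => /eqP <-; rewrite eq_sym eq_invg_mul.
  by rewrite (gen_mulgg invol).
pose Q k := (k <= m)%N && (word_length S (w * (alternating s t k)^-1)%g + k == len w)%N.
have Q1 : exists k, Q k.
  exists 1%N; rewrite /Q ltnW //= mulg1.
  rewrite (gen_invg invol) //.
  by rewrite addn1 lt_t.
have Qb k : Q k -> (k <= m)%N by case/andP.
have [k /andP[le_km /eqP len_k] maxk] := ex_maxnP Q1 Qb.
have k0 : (0 < k)%N.
  apply: (maxk 1%N); rewrite /Q ltnW //= mulg1.
  rewrite (gen_invg invol) //.
  by rewrite addn1 lt_t.
set a := alternating s t k in len_k *; set v := (w * a^-1)%g in len_k *.
have Wa : a \in W by apply: alternating_gen.
have Wv : v \in W by rewrite groupM ?groupV.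
have dw : w = (v * a)%g by rewrite mulgKV.
(* For [k = m] the braid relation would let [a] end in [s], making [w s] shorter than [w]. *)
have lt_km : (k < m)%N.
  rewrite ltn_neqAle le_km andbT; apply: contraTneq le_ws => eq_km.
  have da : a = (alternating s t k.-1 * s)%g.
    by rewrite /a -alternatingSr prednK // eq_km (alternating_braid invol).
  have -> : (w * s = v * alternating s t k.-1)%g.
    by rewrite dw da -!mulgA (gen_mulgg invol) ?mulg1.
  rewrite -ltnNge -len_k (leq_ltn_trans (word_lengthM Wv _)) ?alternating_gen //.
  by rewrite ltn_add2l (leq_ltn_trans (word_length_alternating _ _ _)) // prednK.
(* [r1] would prolong [a] to the left and [r2] is its first letter. Shortening [v] by [r1]
   contradicts the maximality of [k]; by [r2], the length of [w]. *)
pose r1 := if odd k then s else t; pose r2 := if odd k then t else s.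
have Sr1 : r1 \in S by rewrite /r1; case: ifP.
have Sr2 : r2 \in S by rewrite /r2; case: ifP.
have le1 : (len v <= len (v * r1))%N.
  rewrite leqNgt; apply/negP => lt1.
  have : Q k.+1.
    rewrite /Q lt_km /= -/r1 -/a invMg mulgA -/v (gen_invg invol) //.
    rewrite addnS -len_k -addSn eqn_add2r eqn_leq lt1.
    by rewrite (word_length_step invol).
  by move/maxk; rewrite ltnn.
have le2 : (len v <= len (v * r2))%N.
  rewrite leqNgt; apply/negP => lt2.
  have da : a = (r2 * alternating s t k.-1)%g.
    by rewrite /a /r2; case: (k) k0 => //= k' _; case: odd.
  have : (len w <= len (v * r2)%g + k.-1)%N.
    have -> : w = (v * r2 * alternating s t k.-1)%g by rewrite dw da mulgA.
    apply: leq_trans (word_lengthM _ _) _; rewrite ?alternating_gen //.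
      by rewrite groupM // mem_gen.
    by rewrite leq_add2l word_length_alternating.
  by rewrite -len_k leqNgt (leq_ltn_trans (leq_add (ltnW lt2) (leqnn _))) // ltn_add2l prednK.
have ltv : (len v < N)%N by rewrite (leq_trans _ leN) // -len_k -addn1 leq_add2l.
have pos1 := IHN v r1 ltv Wv Sr1 le1; have pos2 := IHN v r2 ltv Wv Sr2 le2.
have [x [y [x0 y0 eqa]]] := rho_alternating rb Ss St neq_st lt_km.
rewrite dw (rho_mul rb) // -mulmxA eqa mulmxDr -!scalemxAr.
by apply: nonneg_root_combD; apply: nonneg_root_combZ => //;
  move: pos1 pos2; rewrite /r1 /r2; case: odd.
Qed.

Lemma rho_root_sign w s : w \in W -> s \in S ->
  if (len w <= len (w * s)%g)%N then nonneg_root_comb (rho w *m al s)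
  else nonneg_root_comb (- (rho w *m al s)).
Proof.
move=> Ww Ss; case: leqP => [|lt_ws]; first exact: nonneg_rho_root.
have Wws : (w * s)%g \in W by rewrite groupM // mem_gen.
have -> : - (rho w *m al s) = rho (w * s)%g *m al s.
  by rewrite (rho_mul rb Ww (mem_gen Ss)) -mulmxA rho_gen_root // mulmxN.
apply: nonneg_rho_root => //.
by rewrite -mulgA (gen_mulgg invol) // mulg1 ltnW.
Qed.

Definition pairing (l : 'rV[algC]_n) (v : 'cV[algC]_n) : algC := (l *m v) 0 0.

Lemma pairing_sumr (I : finType) (P : pred I) l (F : I -> 'cV[algC]_n) :
  pairing l (\sum_(i | P i) F i) = \sum_(i | P i) pairing l (F i).
Proof. by rewrite /pairing mulmx_sumr summxE. Qed.

Lemma pairingZr l a v : pairing l (a *: v) = a * pairing l v.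
Proof. by rewrite /pairing -scalemxAr mxE. Qed.

Lemma pairingNr l v : pairing l (- v) = - pairing l v.
Proof. by rewrite /pairing mulmxN mxE. Qed.

Lemma pairing_dual r s : r \in S -> s \in S -> pairing (om r) (al s) = (r == s)%:R.
Proof. by move=> Sr Ss; rewrite /pairing (dual_root rb) // mxE eqxx. Qed.

Lemma pairing_gen l s v : s \in S ->
  pairing (l *m rho s) v = pairing l v - pairing l (al s) * pairing (be s) v.
Proof.
move=> Ss; rewrite /pairing (rho_gen rb) // mulmxBr mulmx1 mulmxBl mxE; congr (_ + _).
by rewrite mxE !mulmxA -mulmxA mxE big_ord1.
Qed.

Definition dominant l := forall s, s \in S -> 0 <= pairing l (al s).

Definition real_weight l := forall s, s \in S -> pairing l (al s) \is Num.real.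

Lemma dominant_nonneg l v : dominant l -> nonneg_root_comb v -> 0 <= pairing l v.
Proof.
move=> dom [c c0 ->]; rewrite pairing_sumr sumr_ge0 // => r Sr.
by rewrite pairingZr mulr_ge0 // dom.
Qed.

Lemma real_nonneg l v : real_weight l -> nonneg_root_comb v -> pairing l v \is Num.real.
Proof.
move=> rl [c c0 ->]; rewrite pairing_sumr rpred_sum // => r Sr.
by rewrite pairingZr rpredM ?rl // ger0_real.
Qed.

Lemma real_weight_rho l w : real_weight l -> w \in W -> real_weight (l *m rho w).
Proof.
move=> rl Ww s Ss; have := rho_root_sign Ww Ss.
rewrite /pairing -mulmxA -/(pairing l _).
case: ifP => _ /(real_nonneg rl) //.
by rewrite pairingNr rpredN.
Qed.

Definition weight_stab (l : 'rV[algC]_n) := [set w in W | l *m rho w == l].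

Lemma weight_stab_group_set l : group_set (weight_stab l).
Proof.
apply/group_setP; split=> [|x y]; first by rewrite !inE group1 (rho_one rb) mulmx1 eqxx.
rewrite !inE => /andP[Wx /eqP fx] /andP[Wy /eqP fy].
by rewrite groupM //= (rho_mul rb) // mulmxA fx fy.
Qed.

Lemma weight_stabJ l x : x \in W -> weight_stab (l *m rho x) = (weight_stab l :^ x)%g.
Proof.
move=> Wx; apply/setP => w; rewrite mem_conjg !inE groupJr ?groupV //.
case: (boolP (w \in W)) => //= Ww.
have V : rho x *m rho x^-1%g = 1%:M by rewrite -(rho_mul rb) ?groupV // mulgV (rho_one rb).
have V' : rho x^-1%g *m rho x = 1%:M by rewrite -(rho_mul rb) ?groupV // mulVg (rho_one rb).
rewrite conjgE invgK !(rho_mul rb) ?groupM ?groupV // !mulmxA.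
apply/eqP/eqP => [->|]; first by rewrite -mulmxA V mulmx1.
by move=> {2}<-; rewrite -[RHS]mulmxA V' mulmx1.
Qed.

(** Induction on length: if [w] fixes [l] and [w s] is shorter, then [rho w] makes [al s]
    nonpositive, while [l] still takes the value [l (al s) >= 0] there. So this value is 0, and both
    [s] and [w s] fix [l]. *)
Lemma weight_stab_dominant l : dominant l ->
  weight_stab l = <<[set s in S | pairing l (al s) == 0]>>%g.
Proof.
move=> dom; set I := [set s in S | _]; apply/eqP; rewrite eqEsubset; apply/andP; split.
  apply/subsetP => w; have [N] := ubnP (len w); elim: N w => // N IHN w /ltnSE-leN.
  rewrite inE => /andP[Ww /eqP fw]; have [/eqP l0|l0] := posnP (len w).
    by rewrite (word_length0 Ww (eqP l0)) group1.
  have [s Ss lt_s] := word_length_descent invol Ww l0.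
  have ls0 : pairing l (al s) = 0.
    apply/le_anti; rewrite dom // andbT.
    have := rho_root_sign Ww Ss; rewrite leqNgt -lt_s ltnS leqnn /=.
    move/(dominant_nonneg dom); rewrite pairingNr oppr_ge0 /pairing mulmxA fw.
    by [].
  have fs : l *m rho s = l.
    rewrite (rho_gen rb) // mulmxBr mulmx1 mulmxA [l *m al s]mx11_scalar.
    by rewrite -/(pairing l _) ls0 mul_scalar_mx scale0r subr0.
  have Is : s \in I by rewrite inE Ss ls0 eqxx.
  have -> : w = (w * s * s)%g by rewrite -mulgA (gen_mulgg invol) ?mulg1.
  apply: groupM; last exact: mem_gen.
  apply: IHN; first by rewrite -lt_s in leN.
  by rewrite inE groupM ?(mem_gen Ss) //= (rho_mul rb Ww (mem_gen Ss)) mulmxA fw fs eqxx.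
rewrite (gen_subG _ (Group (weight_stab_group_set l))); apply/subsetP => s.
rewrite !inE => /andP[Ss /eqP ls0]; rewrite mem_gen //=.
rewrite (rho_gen rb) // mulmxBr mulmx1 mulmxA [l *m al s]mx11_scalar.
by rewrite -/(pairing l _) ls0 mul_scalar_mx scale0r subr0.
Qed.

End RootPositivity.

(** * Parabolic subgroups *)

Section Parabolics.
Local Open Scope group_scope.
Local Open Scope ring_scope.
Variables (gT : finGroupType) (S : {set gT}) (n : nat) (rho : gT -> 'M[algC]_n).
Variables (al : gT -> 'cV[algC]_n) (be om : gT -> 'rV[algC]_n).
Hypothesis invol : forall s, s \in S -> #[s]%g = 2%N.
Hypothesis rb : root_basis S rho al be om.

Local Notation len := (word_length S).
Local Notation W := <<S>>%g.
Local Notation stab := (weight_stab S rho).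

(* The sum of the positive vectors among the [rho w *m al t], over all pairs [(w, t)]. *)
Lemma coroot_positive_vector : exists2 h, nonneg_root_comb S al h &
  forall s, s \in S -> 0 < pairing (be s) h.
Proof.
pose p w t := (len w <= len (w * t)%g)%N.
pose x (b : bool) w t : 'cV[algC]_n := if b then rho w *m al t else 0.
exists (\sum_(t in S) \sum_(w in W) x (p w t) w t).
  apply: (big_ind (nonneg_root_comb S al)) => [|v v'|t St].
  - exact: nonneg_root_comb0.
  - exact: nonneg_root_combD.
  apply: (big_ind (nonneg_root_comb S al)) => [|v v'|w Ww].
  - exact: nonneg_root_comb0.
  - exact: nonneg_root_combD.
  rewrite /x; case: ifP => [posw|_]; last exact: nonneg_root_comb0.
  exact: (nonneg_rho_root invol rb).
move=> s Ss; set h := \sum_(t in S) _; have Ws := mem_gen Ss.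
have -> : pairing (be s) h = pairing (om s) (h - rho s *m h).
  rewrite (rho_gen rb) // mulmxBl mul1mx opprB addrC subrK /pairing !mulmxA.
  by rewrite (dual_root rb) // eqxx mul_scalar_mx scale1r.
have -> : h - rho s *m h
    = \sum_(t in S) \sum_(w in W) (x (p w t) w t - x (p (s * w)%g t) w t).
  rewrite /h mulmx_sumr -sumrB; apply: eq_bigr => t St.
  rewrite sumrB; congr (_ - _); rewrite mulmx_sumr (reindex_inj (mulgI s)) /=.
  apply: eq_big => [w|w]; first by rewrite groupMl.
  rewrite groupMl // => Ww; rewrite /x; case: ifP => _; last by rewrite mulmx0.
  by rewrite mulmxA -(rho_mul rb) ?groupM // mulgA (gen_mulgg invol) // mul1g.
have om0 v : nonneg_root_comb S al v -> 0 <= pairing (om s) v.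
  apply: dominant_nonneg => r Sr; rewrite (pairing_dual rb) //; exact: ler0n.
have term0 t w : t \in S -> w \in W ->
    0 <= pairing (om s) (x (p w t) w t - x (p (s * w)%g t) w t).
  move=> St Ww; apply: om0; have := rho_root_sign invol rb Ww St.
  rewrite -/(p w t) /x; case: (p w t) => posw; case: (p _ t); rewrite ?subrr ?subr0 ?sub0r //;
    exact: nonneg_root_comb0.
rewrite pairing_sumr (bigD1 s) //= pairing_sumr (bigD1 1%g) //=.
rewrite -!addrA ltr_wpDr //; last first.
  rewrite /x /p mulg1 !mul1g (gen_mulgg invol) //.
  have len1 : len 1%g = 0%N by apply/eqP; rewrite -leqn0 word_length_le ?group1 // expg0 inE.
  have lens : (0 < len s)%N.
    rewrite lt0n; apply/eqP => /(word_length0 Ws) s1.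
    by have := invol Ss; rewrite s1 order1.
  rewrite len1 leq0n leqNgt lens subr0 (rho_one rb) mul1mx (pairing_dual rb) // eqxx.
  exact: ltr01.
rewrite addr_ge0 // sumr_ge0 // => [w /andP[Ww _]|t /andP[St _]]; first exact: term0.
by rewrite pairing_sumr sumr_ge0 // => w Ww; apply: term0.
Qed.

(** Maximise the value of [l *m rho w] at [h]: if it were negative on [al s], passing to [w s] would
    increase the value at [h]. *)
Lemma dominant_conj l : real_weight S al l ->
  exists2 w, w \in W & dominant S al (l *m rho w).
Proof.
move=> rl; have [h h0 hpos] := coroot_positive_vector.
have [w Ww maxw] := @real_arg_max gT (fun w => w \in W)
  (fun w => pairing (l *m rho w) h) 1%g (group1 _)
  (fun w Ww => real_nonneg (real_weight_rho invol rb rl Ww) h0).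
exists w => // s Ss; have rls := real_weight_rho invol rb rl Ww Ss.
rewrite real_leNgt ?rpred0 //; apply/negP => lt0.
have Wws : (w * s)%g \in W by rewrite groupM // mem_gen.
have := maxw _ Wws; rewrite (rho_mul rb) ?(mem_gen Ss) // mulmxA (pairing_gen rb) //.
by rewrite lerBlDr lerDl lt_geF // nmulr_rlt0 // hpos.
Qed.

Definition coweight (J : {set gT}) : 'rV[algC]_n := \sum_(r in S :\: J) om r.

Lemma pairing_coweight J s : s \in S -> pairing (coweight J) (al s) = (s \notin J)%:R.
Proof.
move=> Ss; rewrite /pairing mulmx_suml summxE.
rewrite (eq_bigr (fun r => (r == s)%:R)) => [|r /setDP[Sr _]]; last exact: (pairing_dual rb).
case: (boolP (s \in J)) => Js.
  rewrite big1 // => r /setDP[_ nJr]; apply/eqP; rewrite pnatr_eq0 eqb0.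
  by apply: contraNneq nJr => ->.
rewrite (bigD1 s) ?inE ?Js //= eqxx big1 ?addr0 // => r /andP[_ /negPf->].
by [].
Qed.

Lemma weight_stab_coweight (J : {set gT}) : J \subset S -> stab (coweight J) = <<J>>%g.
Proof.
move=> sJS; rewrite (weight_stab_dominant invol rb); last first.
  by move=> s Ss; rewrite pairing_coweight // ler0n.
congr <<_>>%g; apply/setP => s; rewrite inE.
case: (boolP (s \in S)) => [Ss|nSs]; last first.
  by rewrite /=; apply/esym; apply: contraNF nSs; apply: (subsetP sJS).
by rewrite pairing_coweight // pnatr_eq0 eqb0 negbK.
Qed.

(** A real form has a dominant conjugate, whose stabiliser is generated by simple reflections;
    conversely [<<J>>] is the stabiliser of [coweight J]. *)
Lemma parabolicsP P : reflect (exists2 l, real_weight S al l & P = stab l)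
  (P \in parabolics <<S>>%G S).
Proof.
apply: (iffP imset2P) => [[J x]|[l rl ->]].
  rewrite inE => sJS Wx ->; exists (coweight J *m rho x).
    apply: (real_weight_rho invol rb) => // s Ss.
    by rewrite pairing_coweight // rpred_nat.
  by rewrite (weight_stabJ rb) // weight_stab_coweight.
have [w Ww dom] := dominant_conj rl.
exists [set s in S | pairing (l *m rho w) (al s) == 0] (w^-1)%g; last 1 first.
- by rewrite -(weight_stab_dominant invol rb dom) (weight_stabJ rb) // conjsgK.
- by rewrite inE; apply/subsetP => s; rewrite inE => /andP[].
by rewrite groupV.
Qed.

Lemma parabolicsI P Q : P \in parabolics <<S>>%G S -> Q \in parabolics <<S>>%G S ->
  P :&: Q \in parabolics <<S>>%G S.
Proof.
case/parabolicsP=> l1 r1 ->; case/parabolicsP=> l2 r2 ->; apply/parabolicsP.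
(* An element outside the intersection fixes [l k] for at most one [k]. *)
pose l (k : nat) := l1 + k%:R *: l2.
have rl k : real_weight S al (l k).
  move=> s Ss; rewrite /pairing mulmxDl -scalemxAl mxE rpredD //; first exact: r1.
  by rewrite mxE rpredM ?rpred_nat //; apply: r2.
suff [k eqk] : exists k : 'I_#|gT|.+1, stab (l k) \subset stab l1 :&: stab l2.
  exists (l k); first exact: rl.
  apply/eqP; rewrite eqEsubset eqk andbT; apply/subsetP => w.
  rewrite !inE => /andP[/andP[Ww /eqP f1] /andP[_ /eqP f2]].
  by rewrite Ww /l mulmxDl -scalemxAl f1 f2 eqxx.
apply/existsP; apply: contraT; rewrite negb_exists => /forallP bad.
have /fin_all_exists[f fP] : forall k : 'I_#|gT|.+1, exists w,
    w \in stab (l k) :\: (stab l1 :&: stab l2).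
  by move=> k; have /subsetPn[w wk nw] := bad k; exists w; rewrite inE nw.
have /leq_card : injective f.
  move=> k k' eqf; apply: val_inj; apply: contraTeq (fP k) => neq_k /=.
  have := fP k'; rewrite -eqf !inE.
  case/and3P=> nfix Ww /eqP fk'; rewrite Ww /= in nfix *.
  apply: contra nfix => /andP[_ /eqP fk].
  pose d i := l i *m rho (f k) - l i.
  have dE i : d i = (l1 *m rho (f k) - l1) + i%:R *: (l2 *m rho (f k) - l2).
    by rewrite /d /l mulmxDl -scalemxAl opprD addrACA scalerBr.
  have d0 : d k = 0 by rewrite /d fk subrr.
  have d0' : d k' = 0 by rewrite /d fk' subrr.
  have e2 : l2 *m rho (f k) - l2 = 0.
    have /eqP : d k - d k' = 0 by rewrite d0 d0' subrr.
    rewrite !dE opprD addrACA subrr add0r -scalerBl scaler_eq0 subr_eq0 eqr_nat.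
    by rewrite (negPf neq_k) => /eqP.
  move: d0; rewrite dE e2 scaler0 addr0 => /eqP; rewrite subr_eq0 => ->.
  by rewrite /= -subr_eq0 e2.
by rewrite card_ord ltnn.
Qed.

(** Since intersections of two parabolics are parabolic, one of least order containing [U] lies in
    all the others. *)
Lemma parabolic_closure_parabolic (U : {set gT}) : U \subset W ->
  parabolic_closure <<S>>%G S U \in parabolics <<S>>%G S.
Proof.
move=> sUW.
have WP : W \in parabolics <<S>>%G S.
  by apply/imset2P; exists S 1%g; rewrite ?group1 ?inE ?subxx // conjsg1.
have [P /andP[PP sUP] minP] := @arg_minnP _ W
  (fun P => (P \in parabolics <<S>>%G S) && (U \subset P)) (fun P : {set gT} => #|P|)
  (introT andP (conj WP sUW)).
suff -> : parabolic_closure <<S>>%G S U = P by [].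
apply/eqP; rewrite eqEsubset; apply/andP; split.
  by apply: bigcap_inf; rewrite PP.
apply/bigcapsP => Q /andP[PQ sUQ]; apply/setIidPl/eqP.
rewrite eqEcard subsetIl minP // parabolicsI //.
by rewrite subsetI sUP.
Qed.

End Parabolics.

(** * The geometric representation *)

(** [cox_pres] ranges over group types; the general linear group is made into one to serve as its
    target. *)
Record glmx n := GLmx { glval : 'M[algC]_n; _ : glval \in unitmx }.
HB.instance Definition _ n := [isSub for @glval n].
HB.instance Definition _ n := [Choice of glmx n by <:].

Section GeneralLinear.
Variable n : nat.
Implicit Types x y z : glmx n.
Local Open Scope ring_scope.

Lemma glval_unit x : val x \in unitmx. Proof. by case: x. Qed.
Definition gl_one : glmx n := GLmx (unitmx1 _ n).
Fact gl_inv_subproof x : invmx (val x) \in unitmx.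
Proof. by rewrite unitmx_inv glval_unit. Qed.
Definition gl_inv x := GLmx (gl_inv_subproof x).
Fact gl_mul_subproof x y : val x *m val y \in unitmx.
Proof. by rewrite unitmx_mul !glval_unit. Qed.
Definition gl_mul x y := GLmx (gl_mul_subproof x y).
Fact gl_mulA : associative gl_mul.
Proof. by move=> x y z; apply/val_inj/mulmxA. Qed.
Fact gl_mul1 : left_id gl_one gl_mul.
Proof. by move=> x; apply/val_inj/mul1mx. Qed.
Fact gl_mulr1 : right_id gl_one gl_mul.
Proof. by move=> x; apply/val_inj/mulmx1. Qed.
Fact gl_mulV : left_inverse gl_one gl_inv gl_mul.
Proof. by move=> x; apply/val_inj/mulVmx/glval_unit. Qed.
Fact gl_mulrV : right_inverse gl_one gl_inv gl_mul.
Proof. by move=> x; apply/val_inj/mulmxV/glval_unit. Qed.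

End GeneralLinear.

HB.instance Definition _ n := isGroup.Build (glmx n) (@gl_mulA n) (@gl_mul1 n)
  (@gl_mulr1 n) (@gl_mulV n) (@gl_mulrV n).

Section TitsRepresentation.
Local Open Scope group_scope.
Local Open Scope ring_scope.
Variables (gT : finGroupType) (W : {group gT}) (S : {set gT}).
Hypothesis cox : coxeter_system W S.

Let invol s : s \in S -> #[s]%g = 2%N. Proof. exact: cox_invol cox s. Qed.

Lemma order_mul_gens s t : s \in S -> t \in S -> s != t -> (1 < #[(s * t)%g])%N.
Proof.
move=> Ss St neq_st; rewrite ltn_neqAle order_gt0 eq_sym order_eq1 andbT -eq_invg_mul.
by rewrite (gen_invg invol).
Qed.

Lemma order_mulC s t : s \in S -> t \in S -> #[(s * t)%g] = #[(t * s)%g].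
Proof. by move=> Ss St; rewrite -orderV invMg !(gen_invg invol). Qed.

Section CartanMatrix.
Variable cu : 'I_#|gT|.+1 -> algC * (nat -> algC).
Hypothesis cuP : forall m : 'I_#|gT|.+1, (1 < m)%N ->
  let: (c, u) := cu m in
  [/\ c \is Num.real, c ^+ 2 != 4,
      [/\ u 0%N = 0, u 1%N = 1 & forall k, u k.+2 = c * u k.+1 - u k],
      forall k, (k <= m)%N -> 0 <= u k
    & forall k, u (m + k)%N = - u k].

Definition twocos (s t : gT) := (cu (inord #[(s * t)%g])).1.
Definition sines (s t : gT) := (cu (inord #[(s * t)%g])).2.

Lemma twocosP s t : s \in S -> t \in S -> s != t ->
  let m := #[(s * t)%g] in let c := twocos s t in let u := sines s t in
  [/\ c \is Num.real, c ^+ 2 != 4,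
      [/\ u 0%N = 0, u 1%N = 1 & forall k, u k.+2 = c * u k.+1 - u k],
      forall k, (k <= m)%N -> 0 <= u k
    & forall k, u (m + k)%N = - u k].
Proof.
move=> Ss St neq_st m; rewrite /twocos /sines -/m.
have m_val : (inord m : 'I_#|gT|.+1) = m :> nat.
  by rewrite inordK // ltnS; apply: max_card.
have := @cuP (inord m); rewrite m_val order_mul_gens // => /(_ isT).
by case: (cu _) => c u.
Qed.

Definition cartan (s t : gT) : algC :=
  if t \in S then if s == t then 2 else - twocos s t else 0.

(* There is one coordinate for every element of [gT]; those outside [S] are never used. *)
Definition simple_root (s : gT) : 'cV[algC]_#|gT| := delta_mx (enum_rank s) 0.
Definition simple_weight (s : gT) : 'rV[algC]_#|gT| := delta_mx 0 (enum_rank s).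
Definition simple_coroot (s : gT) : 'rV[algC]_#|gT| := \row_j cartan s (enum_val j).
Definition reflection (s : gT) : 'M[algC]_#|gT| := 1%:M - simple_root s *m simple_coroot s.

Lemma simple_coroot_root s t : simple_coroot s *m simple_root t = (cartan s t)%:M.
Proof.
rewrite [LHS]mx11_scalar; congr _%:M; rewrite mxE (bigD1 (enum_rank t)) //=.
rewrite !mxE !eqxx mulr1 enum_rankK big1 ?addr0 // => j nj.
by rewrite !mxE (negPf nj) mulr0.
Qed.

Lemma simple_weight_root s t : simple_weight s *m simple_root t = (s == t)%:R%:M.
Proof.
rewrite /simple_weight /simple_root mul_delta_mx_cond (inj_eq enum_rank_inj).
by rewrite [LHS]mx11_scalar mulmxnE mxE.
Qed.

Lemma reflection_mul s (v : 'cV_#|gT|) :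
  reflection s *m v = v - (simple_coroot s *m v) 0 0 *: simple_root s.
Proof.
rewrite mulmxBl mul1mx -mulmxA; congr (_ - _).
by rewrite {1}[simple_coroot s *m v]mx11_scalar mul_mx_scalar.
Qed.

Lemma reflection_root s t : reflection s *m simple_root t = simple_root t - cartan s t *: simple_root s.
Proof. by rewrite reflection_mul simple_coroot_root mxE eqxx. Qed.

Lemma reflection_sqr s : s \in S -> reflection s *m reflection s = 1%:M.
Proof.
move=> Ss; rewrite [X in _ *m X]/reflection mulmxBr mulmx1 mulmxA reflection_root.
rewrite /cartan Ss eqxx scaler_nat mulr2n opprD addrA subrr sub0r mulNmx opprK.
by rewrite /reflection subrK.
Qed.

Fixpoint alternating_mx (s t : gT) (k : nat) : 'M[algC]_#|gT| :=
  if k is k'.+1 then (if odd k' then reflection s else reflection t) *m alternating_mx s t k'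
  else 1%:M.

Lemma alternating_mxSr s t k :
  alternating_mx s t k.+1 = alternating_mx t s k *m reflection t.
Proof.
elim: k => [|k IHk] /=; first by rewrite mulmx1 mul1mx.
by move: IHk => /= ->; rewrite mulmxA; case: (odd k).
Qed.

(** Each new letter changes one of the two coefficients, by the recurrence of the sines. *)
Lemma alternating_mx_root s t k : s \in S -> t \in S -> s != t ->
  alternating_mx s t k *m simple_root s =
    if odd k then sines s t k *: simple_root s + sines s t k.+1 *: simple_root t
    else sines s t k.+1 *: simple_root s + sines s t k *: simple_root t.
Proof.
move=> Ss St neq_st; have [_ _ [u0 u1 uS] _ _] := twocosP Ss St neq_st.
have neq_ts : t == s = false by rewrite eq_sym (negPf neq_st).
have ct : twocos t s = twocos s t by rewrite /twocos order_mulC.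
elim: k => [|k IHk] /=; first by rewrite u0 u1 mul1mx scale1r scale0r addr0.
rewrite -mulmxA IHk uS; case: ifP => _ /=; rewrite mulmxDr -!scalemxAr !reflection_root;
  rewrite /cartan Ss St eqxx ?(negPf neq_st) ?neq_ts ?ct.
  apply/matrixP => i j; rewrite !mxE; ring.
apply/matrixP => i j; rewrite !mxE; ring.
Qed.

(** Both simple roots are fixed because the sines change sign after [m] steps, and the common kernel
    of the two coroots is fixed by each letter. Together these span the space. *)
Lemma alternating_mx_order s t : s \in S -> t \in S -> s != t ->
  alternating_mx s t #[(s * t)%g].*2 = 1%:M.
Proof.
move=> Ss St neq_st; set m := #[_]; set M := alternating_mx _ _ _.
have [_ c4 [u0 u1 uS] _ um] := twocosP Ss St neq_st.
have m_gt1 : (1 < m)%N by apply: order_mul_gens.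
set u := sines s t in u0 u1 uS um; set c := twocos s t in c4 uS.
have u2m : u (m + m)%N = 0 by rewrite um -[m]addn0 um u0 !oppr0.
have u2m1 : u (m + m).+1 = 1 by rewrite -addnS um -addn1 um u1 opprK.
have u2m_1 : u (m + m).-1 = -1.
  have := uS (m + m).-1; rewrite prednK ?addn_gt0 ?(ltnW m_gt1) // u2m u2m1 mulr0 sub0r.
  by move=> ->; rewrite opprK.
have neq_ts : t != s by rewrite eq_sym.
have Ms : M *m simple_root s = simple_root s.
  by rewrite alternating_mx_root // odd_double -addnn -/u u2m u2m1 scale1r scale0r addr0.
have Mt : M *m simple_root t = simple_root t.
  rewrite /M -addnn -[(m + m)%N]prednK ?addn_gt0 ?(ltnW m_gt1) // alternating_mxSr.
  rewrite -mulmxA reflection_root /cartan St eqxx scaler_nat mulr2n opprD addrA subrr sub0r.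
  rewrite mulmxN alternating_mx_root // -subn1 oddB ?addn_gt0 ?(ltnW m_gt1) //.
  rewrite addnn odd_double -addnn subn1 prednK ?addn_gt0 ?(ltnW m_gt1) //=.
  have -> : sines t s = u by rewrite /u /sines order_mulC.
  by rewrite u2m u2m_1 scaleN1r scale0r addr0 opprK.
have fix0 (v : 'cV_#|gT|) : simple_coroot s *m v = 0 -> simple_coroot t *m v = 0 -> M *m v = v.
  move=> sv tv; rewrite /M; elim: (_.*2) => [|k IHk] /=; first by rewrite mul1mx.
  rewrite -mulmxA IHk.
  by case: ifP => _; rewrite reflection_mul ?sv ?tv mxE scale0r subr0.
have fixv (v : 'cV_#|gT|) : M *m v = v.
  pose x := (simple_coroot s *m v) 0 0; pose y := (simple_coroot t *m v) 0 0.
  have c40 : 4 - c ^+ 2 != 0 by rewrite subr_eq0 eq_sym.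
  (* [P] and [Q] solve [2 P - c Q = x] and [2 Q - c P = y], so that both coroots vanish on [v0]. *)
  pose P := (2 * x + c * y) / (4 - c ^+ 2); pose Q := (2 * y + c * x) / (4 - c ^+ 2).
  pose v0 := v - P *: simple_root s - Q *: simple_root t.
  have ct : twocos t s = c by rewrite /c /twocos order_mulC.
  have dv : v = v0 + P *: simple_root s + Q *: simple_root t.
    by rewrite /v0 addrAC subrK subrK.
  have s0 : simple_coroot s *m v0 = 0.
    rewrite /v0 !mulmxBr -!scalemxAr !simple_coroot_root /cartan Ss St eqxx (negPf neq_st).
    rewrite [simple_coroot s *m v]mx11_scalar -/x !scale_scalar_mx -!raddfB /=.
    by rewrite (_ : _ - _ = 0) ?raddf0 // -/c /P /Q; field.
  have t0 : simple_coroot t *m v0 = 0.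
    rewrite /v0 !mulmxBr -!scalemxAr !simple_coroot_root /cartan Ss St eqxx (negPf neq_ts) ct.
    rewrite [simple_coroot t *m v]mx11_scalar -/y !scale_scalar_mx -!raddfB /=.
    by rewrite (_ : _ - _ = 0) ?raddf0 // /P /Q; field.
  by rewrite dv; clearbody v0; rewrite !mulmxDr -!scalemxAr Ms Mt (fix0 _ s0 t0).
apply/matrixP => i j; have := congr1 (fun v : 'cV_#|gT| => v i 0) (fixv (delta_mx j 0)).
by rewrite -colE !mxE eqxx andbT.
Qed.

End CartanMatrix.

(** The reflections satisfy the Coxeter relations, so the presentation extends them to [W]; the sign
    of the sines gives [rho_alternating]. *)
Lemma root_basis_exists : exists n (rho : gT -> 'M[algC]_n) al be om,
  root_basis S rho al be om.
Proof.
have /fin_all_exists[cu cuP] : forall m : 'I_#|gT|.+1,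
   exists cu : algC * (nat -> algC), (1 < m)%N ->
  let: (c, u) := cu in
  [/\ c \is Num.real, c ^+ 2 != 4,
      [/\ u 0%N = 0, u 1%N = 1 & forall k, u k.+2 = c * u k.+1 - u k],
      forall k, (k <= m)%N -> 0 <= u k
    & forall k, u (m + k)%N = - u k].
  move=> m; have [m1|_] := boolP (1 < m)%N; last by exists (0, fun=> 0).
  by have [c [u cuP]] := dihedral_sines m1; exists (c, u).
pose refl := reflection cu; have refl_unit s : s \in S -> refl s \in unitmx.
  by move=> Ss; case: (mulmx1_unit (reflection_sqr cu Ss)).
pose f s : glmx #|gT| := insubd (1%g : glmx #|gT|) (refl s).
have fE s : s \in S -> val (f s) = refl s by move=> Ss; rewrite insubdK // refl_unit.
have fX s t k : s \in S -> t \in S ->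
    val ((f s * f t) ^+ k)%g = alternating_mx cu s t k.*2.
  move=> Ss St; elim: k => [|k IHk] //.
  transitivity (val (f s) *m val (f t) *m val ((f s * f t) ^+ k)%g); first by rewrite expgS.
  by rewrite IHk doubleS /= odd_double /= !fE // mulmxA.
have [|g gM gf] := @cox_pres _ _ _ cox (glmx #|gT|) f.
  move=> s t Ss St; apply: val_inj; rewrite fX //.
  have [->|neq_st] := eqVneq s t; last exact: (alternating_mx_order cuP).
  rewrite (gen_mulgg invol) // order1 /= mulmx1.
  exact: reflection_sqr.
have genS : <<S>>%g = W := cox_gen cox.
have gval : {in <<S>>%g &, {morph (fun x => val (g x)) : x y / (x * y)%g >-> x *m y}}.
  by rewrite genS => x y Wx Wy /=; rewrite gM.
have g1 : val (g 1%g) = 1%:M.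
  have g11 : (g 1 * g 1 = g 1 * 1)%g by rewrite -gM ?group1 // !mulg1.
  by move/mulgI: g11 => ->.
have galt s t k : s \in S -> t \in S -> val (g (alternating s t k)) = alternating_mx cu s t k.
  move=> Ss St; elim: k => [|k IHk] /=; first exact: g1.
  rewrite gval ?alternating_gen //; last by case: ifP => _; apply: mem_gen.
  by rewrite IHk; case: ifP => _; rewrite gf ?fE.
exists #|gT|, (fun x => val (g x)), (@simple_root), (simple_coroot cu), (@simple_weight).
split=> // [s Ss|s Ss|r s _ _|s t Ss St neq_st k lt_km].
- by rewrite /= gf // fE.
- by rewrite simple_coroot_root /cartan Ss eqxx.
- exact: simple_weight_root.
have [_ _ _ u0 _] := twocosP cuP Ss St neq_st.
rewrite galt // (alternating_mx_root cuP) //.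
have u0k := u0 _ (ltnW lt_km); have u0k1 := u0 _ lt_km.
case: ifP => _; first by exists (sines cu s t k), (sines cu s t k.+1).
by exists (sines cu s t k.+1), (sines cu s t k).
Qed.

End TitsRepresentation.

(** * Cuspidal elements *)

Section RankOneUpdate.
Local Open Scope ring_scope.

(** [det (M + a r)] is the determinant of [M] bordered by the first row [(1, - r)], hence affine in
    [r]. *)
Lemma det_add_rank1 (R : comNzRingType) n (M : 'M[R]_n) (a : 'cV_n) (x y : 'rV_n) :
  \det (M + a *m (x + y)) + \det M = \det (M + a *m x) + \det (M + a *m y).
Proof.
pose B (c : R) (r : 'rV[R]_n) : 'M_(1 + n) := col_mx (row_mx c%:M (- r)) (row_mx a M).
have detB r : \det (B 1 r) = \det (M + a *m r).
  have : B 1 r *m block_mx 1%:M r 0 1%:M = block_mx 1%:M 0 a (M + a *m r).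
    rewrite -[B 1 r]/(block_mx _ _ _ _) mulmx_block.
    by rewrite !(mulmx1, mul1mx, mulmx0, addr0, addrN) addrC.
  by move/(congr1 determinant); rewrite det_mulmx det_lblock det_ublock !det1 !mulr1 mul1r.
have row0 c r : row 0 (B c r) = row_mx c%:M (- r).
  apply/rowP => j; rewrite mxE -[RHS](col_mxEu _ (row_mx a M)).
  by congr (B c r _ j); apply: val_inj.
have row'0 c r c' r' : row' 0 (B c r) = row' 0 (B c' r').
  by apply/matrixP => i j; rewrite !mxE; case: splitP => // k; case: k => -[].
have dB r r' : \det (B 1 (r + r')) = \det (B 1 r) + \det (B 0 r').
  have := @determinant_multilinear _ _ (B 1 (r + r')) (B 1 r) (B 0 r') 0 1 1.
  rewrite !mul1r; apply; rewrite ?(row'0 _ _ 1 (r + r')) //.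
  by rewrite !row0 !scale1r add_row_mx opprD raddf0 addr0.
have eqM : M = M + a *m 0 by rewrite mulmx0 addr0.
by rewrite -detB dB [in LHS]eqM -!detB -addrA -[in RHS](add0r y) dB [\det (B 0 y) + _]addrC.
Qed.

End RankOneUpdate.

Section CuspidalElements.
Local Open Scope group_scope.
Local Open Scope ring_scope.
Variables (gT : finGroupType) (S : {set gT}) (n : nat) (rho : gT -> 'M[algC]_n).
Variables (al : gT -> 'cV[algC]_n) (be om : gT -> 'rV[algC]_n).
Hypothesis invol : forall s, s \in S -> #[s]%g = 2%N.
Hypothesis rb : root_basis S rho al be om.
Variable J : {set gT}.
Hypothesis sJS : J \subset S.

Local Notation W := <<S>>%g.
Local Notation WJ := <<J>>%G.
Local Notation N := 'N_<<S>>(<<J>>)%G.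

Let sWJ : WJ \subset W. Proof. exact: genS. Qed.
Let rhoM := rho_mul rb.

(* The projection onto the span of the roots of [W_J] along the fixed space of [W_J]. *)
Definition essential_proj : 'M[algC]_n := 1%:M - avg_mx rho <<J>>.
(** On [N] this is [det (1 - w)] on the span of the roots of [W_J]: the kernel of [essential_proj]
    contributes the factor 1. *)
Definition cuspidal_det (w : gT) : algC := \det (1%:M - rho w *m essential_proj).

Let e := essential_proj.

Lemma essential_proj_idem : e *m e = e.
Proof.
rewrite {2}/e /essential_proj mulmxBr mulmx1 mulmxBl mul1mx.
by rewrite (avg_mx_idem rhoM sWJ) subrr subr0.
Qed.

Lemma essential_projC w : w \in N -> rho w *m e = e *m rho w.
Proof.
move=> Nw; rewrite mulmxBr mulmxBl mulmx1 mul1mx; congr (_ - _).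
exact: (avg_mxC rhoM sWJ).
Qed.

Lemma locally_integral_cuspidal p : locally_integral p N cuspidal_det.
Proof.
apply: (@locally_integral_det1B _ N _ (fun w => rho w *m e)) => x y Nx Ny.
have [Wx _] := setIP Nx; have [Wy _] := setIP Ny.
rewrite (rhoM Wx Wy) -!mulmxA; congr (_ *m _).
by rewrite mulmxA -(essential_projC Ny) -mulmxA essential_proj_idem.
Qed.

(** Write [P] as the stabiliser of a form [l]. Then [rho w *m e] fixes [l *m e], so a nonzero
    determinant forces [l *m e = 0], that is, [W_J] fixes [l]. *)
Lemma cuspidal_det_parabolic w P : w \in N -> P \in parabolics <<S>>%G S -> w \in P ->
  cuspidal_det w != 0 -> WJ \subset P.
Proof.
move=> Nw /(parabolicsP invol rb)[l _ ->]; rewrite inE => /andP[Ww /eqP fw].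
apply: contraR => nsub; apply/det0P; exists (l *m e).
  apply: contra nsub; rewrite mulmxBr mulmx1 subr_eq0 => /eqP fl.
  apply/subsetP => z Jz; rewrite inE (subsetP sWJ) //=.
  by rewrite {1}fl -mulmxA (avg_mxr rhoM sWJ) // -fl.
rewrite mulmxBr mulmx1 (essential_projC Nw) mulmxA -(mulmxA l) essential_proj_idem.
by rewrite -mulmxA -(essential_projC Nw) mulmxA fw subrr.
Qed.

Definition avg_det (X : 'M[algC]_n) := \sum_(w in WJ) \det (1%:M - rho w *m X).

(* The difference [Phi X z] is additive in [z] and vanishes at [z = be s *m X], because
   [X - al s *m (be s *m X) = rho s *m X]; replacing [X] by [X - al s *m y] gives [be s *m X] any
   desired value and does not change [Phi X z]. *)
Lemma avg_det_rank1 s (X : 'M[algC]_n) (z : 'rV_n) : s \in J ->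
  avg_det (X - al s *m z) = avg_det X.
Proof.
move=> Js; have Ss := subsetP sJS s Js.
pose Phi Y y := avg_det (Y - al s *m y) - avg_det Y.
have PhiE Y y : Phi Y y =
    \sum_(w in WJ) (\det (1%:M - rho w *m Y + rho w *m al s *m y) - \det (1%:M - rho w *m Y)).
  rewrite /Phi /avg_det -sumrB; apply: eq_bigr => w _; congr (\det _ - _).
  by rewrite mulmxBr opprB addrA addrAC mulmxA.
have PhiD Y y y' : Phi Y (y + y') = Phi Y y + Phi Y y'.
  rewrite !PhiE -big_split /=; apply: eq_bigr => w _.
  set M := 1%:M - _; set a := rho w *m al s.
  have := det_add_rank1 M a y y'; move/(canRL (addrK _)) => ->.
  by rewrite -addrA [RHS]addrACA.
have Phi_s Y : Phi Y (be s *m Y) = 0.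
  rewrite /Phi; apply/eqP; rewrite subr_eq0; apply/eqP.
  have -> : Y - al s *m (be s *m Y) = rho s *m Y.
    by rewrite (rho_gen rb) // mulmxBl mul1mx mulmxA.
  rewrite /avg_det [RHS](reindex_inj (mulIg s)) /=.
  have WJs : s \in <<J>>%g by apply: mem_gen.
  apply: eq_big => [w|w Jw]; first by rewrite groupMr.
  by rewrite mulmxA rhoM ?(subsetP sWJ).
suff : Phi X z = 0 by move/eqP; rewrite subr_eq0 => /eqP.
pose y := 2^-1 *: (be s *m X - z).
have <- := Phi_s (X - al s *m y).
have -> : be s *m (X - al s *m y) = z.
  rewrite mulmxBr mulmxA (coroot_root rb) // mul_scalar_mx scalerA mulfV ?pnatr_eq0 //.
  by rewrite scale1r subKr.
have -> : Phi X z = Phi X (y + z) - Phi X y by rewrite PhiD addrC addKr.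
rewrite /Phi opprB addrA subrK; congr (avg_det _ - _).
by rewrite mulmxDr opprD addrA.
Qed.

(** The [X] whose right multiples can be subtracted without changing [avg_det] are closed under sums
    and right multiplication. They include [al s *m be s] for [s] in [J], hence every [1 - rho z],
    hence [e]; so [avg_det] agrees at [e] and at 0. *)
Lemma sum_cuspidal_det : \sum_(w in WJ) cuspidal_det w = #|WJ|%:R.
Proof.
pose Q (X : 'M[algC]_n) := forall Z Y, avg_det (Y - X *m Z) = avg_det Y.
have QD X Y : Q X -> Q Y -> Q (X + Y).
  by move=> QX QY Z Y0; rewrite mulmxDl opprD addrA QY QX.
have QM X Z : Q X -> Q (X *m Z) by move=> QX Z' Y; rewrite -mulmxA QX.
have Q0 : Q 0 by move=> Z Y; rewrite mul0mx subr0.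
have QZ c X : Q X -> Q (c *: X).
  by move=> QX Z Y; rewrite -scalemxAl scalemxAr QX.
have Q_rho z : z \in <<J>>%g -> Q (1%:M - rho z).
  case/gen_prodgP=> k [c Jc ->].
  suff [] : (\prod_(i < k) c i)%g \in <<J>>%g /\ Q (1%:M - rho (\prod_(i < k) c i)%g) by [].
  apply: (big_ind (fun x => x \in <<J>>%g /\ Q (1%:M - rho x))) => [|x y [Jx Qx] [Jy Qy]|i _].
  - by rewrite group1 (rho_one rb) subrr.
  - split; first by rewrite groupM.
    rewrite rhoM ?(subsetP sWJ) //.
    have -> : 1%:M - rho x *m rho y = (1%:M - rho x) *m rho y + (1%:M - rho y).
      by rewrite mulmxBl mul1mx [RHS]addrC addrA subrK.
    by apply: QD => //; apply: QM.
  split; first exact: mem_gen.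
  rewrite (rho_gen rb) ?(subsetP sJS) // subKr => Z Y.
  by rewrite -mulmxA avg_det_rank1.
have Qe : Q e.
  have -> : e = (#|WJ|%:R)^-1 *: \sum_(z in <<J>>%g) (1%:M - rho z).
    rewrite sumrB sumr_const scalerBr -scaler_nat scalerA mulVf ?scale1r //.
    by rewrite pnatr_eq0 -lt0n cardG_gt0.
  by apply: QZ; apply: big_ind => // z; apply: Q_rho.
rewrite -[LHS]/(avg_det e).
have := Qe (- 1%:M) 0; rewrite mulmxN mulmx1 opprK add0r => ->.
rewrite /avg_det (eq_bigr (fun=> 1)) => [|w _]; last by rewrite mulmx0 subr0 det1.
by rewrite sumr_const.
Qed.

End CuspidalElements.

(** * Parabolic marks *)

Section LocallyIntegralComb.
Local Open Scope ring_scope.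
Variables (gT : finGroupType) (p : nat) (N : {group gT}).

Lemma eq_locally_integral (g h : gT -> algC) :
  {in N, g =1 h} -> locally_integral p N g -> locally_integral p N h.
Proof.
move=> eq_gh [gJ gA gP]; split=> [x y Nx Ny|x Nx|u P Nu pu sPC pP].
- by rewrite -!eq_gh ?groupJ // gJ.
- by rewrite -eq_gh // gA.
rewrite (eq_bigr (fun z => g (u * z)%g)) => [|z Pz]; first exact: gP.
have /setIP[Nz _] := subsetP sPC z Pz.
by rewrite eq_gh // groupM.
Qed.

Lemma locally_integral_comb (a b : int) (g h : gT -> algC) :
  locally_integral p N g -> locally_integral p N h ->
  locally_integral p N (fun x => a%:~R * g x + b%:~R * h x).
Proof.
move=> [gJ gA gP] [hJ hA hP]; split=> [x y Nx Ny|x Nx|u P Nu pu sPC pP].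
- by rewrite gJ ?hJ.
- by rewrite rpredD // rpredM ?Aint_int ?gA ?hA.
rewrite big_split -!mulr_sumr mulrDl -!mulrA.
by rewrite rpredD // rpredM ?Aint_int ?gP ?hP.
Qed.

End LocallyIntegralComb.

Section ParabolicMarks.
Local Open Scope group_scope.
Variables (gT : finGroupType) (S : {set gT}).
Implicit Types J K P Q U : {set gT}.

Local Notation W := <<S>>%G.
Local Notation cl U := (parabolic_closure W S U).

Lemma mem_parabolics J x : J \subset S -> x \in W -> <<J>> :^ x \in parabolics W S.
Proof. by move=> sJS Wx; apply/imset2P; exists J x; rewrite ?inE. Qed.

Lemma parabolicsJ P x : P \in parabolics W S -> x \in W -> P :^ x \in parabolics W S.
Proof.
case/imset2P=> J y; rewrite inE => sJS Wy -> Wx.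
by rewrite -conjsgM mem_parabolics ?groupM.
Qed.

Lemma sub_parabolic_closure U : U \subset cl U.
Proof. by apply/bigcapsP => P /andP[]. Qed.

Lemma parabolic_closure_min U P : P \in parabolics W S -> (cl U \subset P) = (U \subset P).
Proof.
move=> PP; apply/idP/idP => [|sUP]; first exact: subset_trans (sub_parabolic_closure U).
by apply: bigcap_inf; rewrite PP.
Qed.

Lemma parabolic_closureJ U x : x \in W -> cl (U :^ x) = cl U :^ x.
Proof.
move=> Wx; suff sub V y : y \in W -> cl V :^ y \subset cl (V :^ y).
  apply/eqP; rewrite eqEsubset sub // andbT -sub_conjgV.
  by rewrite -[X in _ \subset cl X](conjsgK x) sub ?groupV.
move=> Wy; apply/bigcapsP => P /andP[PP sVP]; rewrite sub_conjg.
by rewrite parabolic_closure_min ?parabolicsJ ?groupV // -sub_conjg.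
Qed.

Definition fix_cosets J U := 'Fix_(rcosets <<J>> W | 'Rs)(U).

Lemma astab1_rcoset J x : 'C[<<J>> :* x | 'Rs] = <<J>> :^ x.
Proof. by rewrite -{2}(astab1Rs <<J>>%G) -astab1_act /= rcosetE. Qed.

Lemma mem_fix_cosets J U x : x \in W ->
  (<<J>> :* x \in fix_cosets J U) = (U \subset <<J>> :^ x).
Proof.
move=> Wx; rewrite inE -sub_astab1 astab1_rcoset andb_idl // => _.
by rewrite -rcosetE imset_f.
Qed.

(** The stabiliser of a coset is a conjugate of [<<J>>]; being parabolic, it contains [U] exactly
    when it contains the closure. *)
Lemma fix_cosets_closure J U : J \subset S -> fix_cosets J (cl U) = fix_cosets J U.
Proof.
move=> sJS; apply/setP => B; case: (boolP (B \in rcosets <<J>> W)) => [|nB].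
  by case/rcosetsP=> x Wx ->; rewrite !mem_fix_cosets // parabolic_closure_min ?mem_parabolics.
by rewrite !inE (negPf nB).
Qed.

Lemma fix_cosets_subset J U : J \subset S -> fix_cosets J U != set0 ->
  exists2 x, x \in W & U \subset <<J>> :^ x.
Proof.
move=> sJS /set0Pn[B FB]; have /rcosetsP[x Wx defB] : B \in rcosets <<J>> W by case/setIP: FB.
by exists x; rewrite // -mem_fix_cosets // -defB.
Qed.

Lemma card_fix_cosetsJ J U x : x \in W -> #|fix_cosets J (U :^ x)| = #|fix_cosets J U|.
Proof.
move=> Wx; rewrite -[RHS](card_imset _ (act_inj 'Rs x)); congr #|pred_of_set _|.
apply/setP => B; apply/idP/imsetP => [FB|[C FC ->]].
  have /rcosetsP[y Wy defB] : B \in rcosets <<J>> W by case/setIP: FB.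
  exists (<<J>> :* (y * x^-1)); last by rewrite /= rcosetE -rcosetM mulgKV.
  rewrite mem_fix_cosets ?groupM ?groupV // conjsgM -sub_conjg.
  by rewrite -mem_fix_cosets // -defB.
have /rcosetsP[y Wy defC] : C \in rcosets <<J>> W by case/setIP: FC.
rewrite defC /= rcosetE -rcosetM mem_fix_cosets ?groupM // conjsgM conjSg.
by rewrite -mem_fix_cosets // -defC.
Qed.

Lemma card_fix_cosets_self J : J \subset S -> #|fix_cosets J <<J>>| = #|'N_W(<<J>>) : <<J>>|.
Proof.
move=> sJS; congr #|pred_of_set _|; apply/setP => B.
apply/idP/rcosetsP => [FB|[x /setIP[Wx nJx] ->]].
  have /rcosetsP[x Wx defB] : B \in rcosets <<J>> W by case/setIP: FB.
  exists x => //; rewrite inE Wx -groupV; apply/normP/eqP.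
  rewrite eqEcard cardJg leqnn andbT sub_conjgV.
  by rewrite -mem_fix_cosets // -defB.
by rewrite mem_fix_cosets // (normP nJx).
Qed.

Lemma mark_fix_cosets J K : mark W J K = #|fix_cosets J K|.
Proof. by rewrite /fix_cosets /mark afix_gen. Qed.

Lemma mark_closure J K w : J \subset S -> w \in W -> cl <[w]> \in <<K>> :^: W ->
  mark W J K = #|'Fix_(rcosets <<J>> W | 'Rs)[w]|.
Proof.
move=> sJS Ww /imsetP[x Wx clw]; rewrite -afix_cycle -[RHS]/#|fix_cosets J <[w]>|.
rewrite -(fix_cosets_closure _ sJS) clw card_fix_cosetsJ //.
Qed.

Lemma mark_conj J K x : x \in W -> mark W (J :^ x) K = mark W J K.
Proof.
move=> Wx; rewrite !mark_fix_cosets.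
have mulx_inj : injective (fun B : {set gT} => x^-1 *: B).
  by apply: (can_inj (g := fun B => x *: B)) => B; rewrite -lcosetM mulgV lcoset1.
rewrite -[RHS](card_imset _ mulx_inj); congr #|pred_of_set _|.
have mulxE y : x^-1 *: (<<J>> :* y) = <<J :^ x>> :* (x^-1 * y).
  rewrite genJ; apply/setP => z; rewrite mem_lcoset mem_rcoset invgK mem_rcoset.
  by rewrite mem_conjg conjgE invMg invgK !mulgA mulgK.
apply/setP => B; apply/idP/imsetP => [FB|[C FC ->]].
  have /rcosetsP[y Wy defB] : B \in rcosets <<J :^ x>> W by case/setIP: FB.
  exists (<<J>> :* (x * y)); last by rewrite mulxE mulKg.
  rewrite mem_fix_cosets ?groupM // conjsgM -genJ.
  by rewrite -mem_fix_cosets // -defB.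
have /rcosetsP[y Wy defC] : C \in rcosets <<J>> W by case/setIP: FC.
rewrite defC mulxE mem_fix_cosets ?groupM ?groupV // genJ -conjsgM mulKVg.
by rewrite -mem_fix_cosets // -defC.
Qed.

End ParabolicMarks.

(** * Functions of the parabolic closure and the descent by marks *)

Section GoodFunctions.
Local Open Scope group_scope.
Local Open Scope ring_scope.
Variables (gT : finGroupType) (S : {set gT}) (p : nat).
Hypothesis p_pr : prime p.

Local Notation W := <<S>>%G.
Local Notation cl U := (parabolic_closure W S U).

(** Integrality is asked of the product with every locally integral [g], so that [cuspidal_det] can
    be inserted as a test function. *)
Record good (phi : {set gT} -> int) : Prop := Good {
  good_conj : forall P x, x \in W -> phi (P :^ x)%g = phi P;
  good_integral : forall (N : {group gT}) g, N \subset W -> locally_integral p N g ->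
    locally_integral p N (fun w => (phi (cl <[w]>%g))%:~R * g w)
}.

Lemma good_comb (a b : int) phi psi : good phi -> good psi ->
  good (fun P => a * phi P + b * psi P).
Proof.
move=> [phiJ phiI] [psiJ psiI]; split=> [P x Wx|N g sNW gI].
  by rewrite phiJ ?psiJ.
apply: eq_locally_integral (locally_integral_comb a b (phiI N g sNW gI) (psiI N g sNW gI)).
by move=> w _; rewrite /= !mulrA -mulrDl rmorphD !rmorphM.
Qed.

Lemma good_mark (J : {set gT}) : J \subset S -> good (fun P => #|fix_cosets S J P|%:Z).
Proof.
move=> sJS; split=> [P x Wx|N g sNW gI]; first by rewrite card_fix_cosetsJ.
have actsN : [acts N, on rcosets <<J>> W | 'Rs]%g.
  exact: subset_trans sNW (actsRs_rcosets <<J>>%G W).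
apply: eq_locally_integral (locally_integral_fix actsN gI) => w _.
by rewrite fix_cosets_closure // /fix_cosets afix_cycle.
Qed.

(** On a coset [u P] the factor is constant, equal to its value at [u], and comes out of the
    average. *)
Lemma good_section phi :
  (forall P x, x \in W -> phi (P :^ x)%g = phi P) ->
  (forall w, w \in W -> phi (cl <[w]>%g) = phi (cl <[w.`_p^']>%g)) -> good phi.
Proof.
move=> phiJ phi_p'; split=> // N g sNW [gJ gA gP].
split=> [x y Nx Ny|x Nx|u P Nu pu sPC pP].
- by rewrite cycleJ parabolic_closureJ ?(subsetP sNW) // phiJ ?gJ // (subsetP sNW).
- by rewrite rpredM ?Aint_int ?gA.
rewrite (eq_bigr (fun z => (phi (cl <[u]>%g))%:~R * g (u * z)%g)) => [|z Pz].
  by rewrite -mulr_sumr -mulrA rpredM ?Aint_int ?gP.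
have /setIP[Nz /cent1P zu] := subsetP sPC z Pz.
have [du _] := constt_mul_commute (esym zu) pu (mem_p_elt pP Pz).
by rewrite phi_p' ?du // (subsetP sNW) // groupM.
Qed.

Variables (n : nat) (rho : gT -> 'M[algC]_n).
Variables (al : gT -> 'cV[algC]_n) (be om : gT -> 'rV[algC]_n).
Hypothesis invol : forall s, s \in S -> #[s]%g = 2%N.
Hypothesis rb : root_basis S rho al be om.

Lemma cuspidal_closure (J : {set gT}) w : J \subset S -> w \in 'N_W(<<J>>)%g ->
  cuspidal_det rho J w != 0 -> <<J>>%g \subset cl <[w]>%g.
Proof.
move=> sJS Nw w0; apply/bigcapsP => P /andP[PP /subsetP sPw].
apply: (cuspidal_det_parabolic invol rb sJS Nw PP) w0.
by apply: sPw; apply: cycle_id.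
Qed.

(** The values of [cuspidal_det] on [<<J>>] have a nonzero sum, so one is nonzero, and the closure
    of such an element cannot be smaller than [<<J>>]. *)
Lemma cuspidal_exists (J : {set gT}) : J \subset S -> exists2 w, w \in <<J>>%g & cl <[w]>%g = <<J>>%g.
Proof.
move=> sJS; have [w Jw w0] : exists2 w, w \in <<J>>%g & cuspidal_det rho J w != 0.
  apply/exists_inP; apply: contraT; rewrite negb_exists => /forallP all0.
  have := sum_cuspidal_det rb sJS; rewrite big1 => [/eqP|w Jw].
    by rewrite eq_sym pnatr_eq0 eqn0Ngt cardG_gt0.
  by have := all0 w; rewrite [w \in _]Jw negbK => /eqP.
exists w => //; apply/eqP; rewrite eqEsubset cuspidal_closure ?andbT //.
  rewrite parabolic_closure_min ?cycle_subG //.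
  by rewrite -(conjsg1 <<J>>) mem_parabolics ?group1.
by rewrite inE (subsetP (genS sJS)) // (subsetP (normG _)).
Qed.

Lemma good_dvd phi (J : {set gT}) : good phi -> J \subset S ->
  (forall I : {set gT}, I \subset S -> (#|<<J>>%g| < #|<<I>>%g|)%N -> phi <<I>>%g = 0) ->
  (#|'N_W(<<J>>) : <<J>>|%g`_p %| `|phi <<J>>%g|)%N.
Proof.
move=> phi_good sJS phi0; pose N := 'N_W(<<J>>)%G.
have sNW : N \subset W by apply: subsetIl.
have sJN : <<J>>%g \subset N by rewrite subsetI genS // normG.
(* Where [cuspidal_det] is nonzero the closure contains [<<J>>]: inside [<<J>>] it is equal to it,
   outside it is larger and [phi] vanishes. *)
have sumE : \sum_(w in N) (phi (cl <[w]>%g))%:~R * cuspidal_det rho J w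
    = (phi <<J>>%g)%:~R * #|<<J>>%g|%:R.
  rewrite -(sum_cuspidal_det rb sJS) mulr_sumr (big_setID <<J>>%g) /= (setIidPr sJN).
  rewrite [X in _ + X]big1 ?addr0.
    apply: eq_bigr => w Jw; have [->|w0] := eqVneq (cuspidal_det rho J w) 0; first by rewrite !mulr0.
    suff -> : cl <[w]>%g = <<J>>%g by [].
    apply/eqP; rewrite eqEsubset cuspidal_closure ?(subsetP sJN) // andbT.
    rewrite parabolic_closure_min ?cycle_subG //.
    by rewrite -(conjsg1 <<J>>) mem_parabolics ?group1.
  move=> w /setDP[Nw nJw].
  have [->|w0] := eqVneq (cuspidal_det rho J w) 0; first by rewrite mulr0.
  have sJw := cuspidal_closure sJS Nw w0.
  have : cl <[w]>%g \in parabolics W S.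
    apply: (parabolic_closure_parabolic invol rb); rewrite cycle_subG.
    exact: (subsetP sNW).
  case/imset2P=> I x; rewrite inE => sIS Wx dcl.
  rewrite dcl (good_conj phi_good) // phi0 ?mul0r //.
  rewrite -(cardJg <<I>> x) -dcl proper_card // properEneq sJw andbT.
  apply: contraNneq nJw => ->; apply: (subsetP (sub_parabolic_closure _ _)).
  exact: cycle_id.
have := sum_locally_integral p_pr
  (good_integral phi_good sNW (locally_integral_cuspidal rb sJS p)).
rewrite sumE => intA.
have {intA} intC : (phi <<J>>%g)%:~R * #|<<J>>%g|%:R / (#|N|`_p)%:R \is a @Num.int algC.
  apply: (Cint_rat_Aint _ intA).
  by rewrite rpred_div ?rpredM ?rpred_nat ?rpred_int.
have : (#|N|`_p %| `|phi <<J>>%g| * #|<<J>>%g|)%N.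
  have /intrP[k eqk] := intC.
  have N0 : (#|N|`_p)%:R != 0 :> algC by rewrite pnatr_eq0 -lt0n part_gt0.
  move/(canRL (divfK N0)): eqk; rewrite !pmulrn -!intrM => /intr_inj eqk.
  by apply/dvdnP; exists `|k|%N; have := congr1 absz eqk; rewrite !abszM.
have -> : (#|N|`_p = #|<<J>>%g|`_p * #|N : <<J>>|%g`_p)%N by rewrite -(Lagrange sJN) partnM.
have {2}-> : (#|<<J>>%g| = #|<<J>>%g|`_p * #|<<J>>%g|`_p^')%N by rewrite partnC.
rewrite mulnCA dvdn_pmul2l ?part_gt0 // Gauss_dvdl //.
exact: coprime_partC.
Qed.

Lemma good_congr phi (K L : {set gT}) : good phi -> K \subset S -> L \subset S ->
  (forall J : {set gT}, J \subset S -> mark W J K = mark W J L %[mod p]) ->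
  (p %| (phi <<K>>%g - phi <<L>>%g))%Z.
Proof.
move=> phi_good sKS sLS eqKL; pose supp (phi : {set gT} -> int) (J : {set gT}) := (J \subset S) && (phi <<J>>%g != 0).
suff: forall b phi, good phi -> (forall J, supp phi J -> (#|<<J>>%g| <= b)%N) ->
    (p %| (phi <<K>>%g - phi <<L>>%g))%Z.
  by move/(_ #|gT| _ phi_good); apply=> J _; apply: max_card.
(* [b] bounds the orders in the support of [phi]; the inner induction on [c] counts the subsets
   reaching the bound. *)
move=> b {phi phi_good}; elim: b => [|b IHb] phi phi_good leb.
  have phi0 (J : {set gT}) : J \subset S -> phi <<J>>%g = 0.
    move=> sJS; apply: contraTeq (cardG_gt0 <<J>>%G) => nz.
    by rewrite -leqNgt leb // /supp sJS.
  by rewrite !phi0 // subrr dvdz0.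
have [c] := ubnP #|[set J | supp phi J & #|<<J>>%g| == b.+1]|.
elim: c phi phi_good leb => // c IHc phi phi_good leb /ltnSE-le_c.
have [top0|[J]] := set_0Vmem [set J | supp phi J & #|<<J>>%g| == b.+1].
  apply: IHb => // J sJ; have := leb J sJ; rewrite leq_eqVlt ltnS => /orP[eqb|//].
  by have := in_set0 J; rewrite -top0 inE sJ eqb.
rewrite inE => /andP[/andP[sJS nzJ] /eqP cardJ].
pose i := #|'N_W(<<J>>)%g : <<J>>%g|%g.
have dvi : (i`_p %| `|phi <<J>>%g|)%N.
  apply: good_dvd => // I sIS ltI; apply: contraTeq ltI => nz.
  by rewrite -leqNgt cardJ leb // /supp sIS.
(* Scaling by the part of [i] prime to [p] makes the value at [J] a multiple of [i], the mark at
   [J]; [psi] subtracts that multiple of the mark. *)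
have [a eqa] : exists a : int, (i`_p^')%N%:Z * phi <<J>>%g = a * i%:Z.
  have /dvdzP[q ->] : ((i`_p)%N%:Z %| phi <<J>>%g)%Z by rewrite dvdzE.
  by exists q; rewrite mulrCA -PoszM mulnC partnC // indexg_gt0.
pose mk P := #|fix_cosets S J P|%:Z.
pose psi P := (i`_p^')%N%:Z * phi P + (- a) * mk P.
have psi_good : good psi by apply: good_comb => //; apply: good_mark.
have mkJ : mk <<J>>%g = i%:Z by rewrite /mk card_fix_cosets_self.
have sub_mk (I : {set gT}) : I \subset S -> mk <<I>>%g != 0 ->
    exists2 x, x \in W & (<<I>> \subset <<J>> :^ x)%g.
  by rewrite eqz_nat cards_eq0 => sIS; apply: fix_cosets_subset.
have : (p %| (psi <<K>>%g - psi <<L>>%g))%Z.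
  apply: IHc => // [I /andP[sIS nz]|].
    have [phi0|phi0] := eqVneq (phi <<I>>%g) 0; last by apply: leb; rewrite /supp sIS.
    have : mk <<I>>%g != 0 by apply: contraNneq nz => mk0; rewrite /psi phi0 mk0 !mulr0.
    case/(sub_mk I sIS)=> x Wx /subset_leq_card; rewrite cardJg cardJ; exact.
  (* At order [b.+1] the mark is nonzero only on conjugates of [<<J>>], where [phi] is already
     nonzero; so nothing enters the support there, and [J] leaves it. *)
  apply: leq_trans le_c; apply: proper_card; apply/properP; split.
    apply/subsetP => I; rewrite !inE => /andP[/andP[sIS nz] cardI].
    rewrite cardI andbT /supp sIS /=; apply: contraNneq nz => phi0.
    have [mk0|mkI] := eqVneq (mk <<I>>%g) 0; first by rewrite /psi phi0 mk0 !mulr0.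
    have [x Wx sIJ] := sub_mk I sIS mkI.
    have eqI : <<I>>%g = (<<J>> :^ x)%g.
      by apply/eqP; rewrite eqEcard sIJ cardJg cardJ /=; move/eqP: cardI => ->.
    by move: phi0 nzJ; rewrite eqI (good_conj phi_good) // => ->; rewrite eqxx.
  exists J; first by rewrite !inE /supp sJS nzJ cardJ eqxx.
  rewrite !inE /supp sJS /= /psi mkJ eqa mulNr subrr eqxx.
  by [].
rewrite /psi opprD addrACA -mulrBr -mulrBr.
have dv_mk : (p %| - a * (mk <<K>>%g - mk <<L>>%g))%Z.
  apply: dvdz_mull; rewrite -eqz_mod_dvd !modz_nat eqz_nat.
  by have := eqKL J sJS; rewrite /mark => ->.
rewrite rpredDr // Gauss_dvdzr // coprimezE /= prime_coprime // -p'natE //.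
exact: part_pnat.
Qed.

End GoodFunctions.

(** * Classes of the relation generated by parrow *)

Section DecompositionClasses.
Local Open Scope group_scope.
Variables (gT : finGroupType) (S : {set gT}) (p : nat) (E : {set {set gT}}).
Hypothesis p_pr : prime p.

Local Notation W := <<S>>%G.
Local Notation cl U := (parabolic_closure W S U).

Hypothesis repE : conj_representatives W S E.

Lemma conj_representatives_sub J : J \in E -> J \subset S.
Proof.
by case/and3P: repE => _ /subsetP sES _ /sES; rewrite inE.
Qed.

Lemma conj_representative_exists (I : {set gT}) : I \subset S ->
  exists2 J, J \in E & I \in J :^: W.
Proof.
move=> sIS; have [_ _ /forall_inP trE] := and3P repE.
have /trE/cards1P[J defJ] : [set K in powerset S | K \in I :^: W]
    \in equivalence_partition (fun J K : {set gT} => K \in J :^: W) (powerset S).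
  by apply/imsetP; exists I; rewrite ?inE.
have : J \in E :&: [set K in powerset S | K \in I :^: W] by rewrite defJ set11.
rewrite !inE => /andP[EJ /andP[_ /imsetP[x Wx defI]]]; exists J => //.
by apply/imsetP; exists x^-1; rewrite ?groupV // defI conjsgK.
Qed.

Lemma parabolic_type P : P \in parabolics W S -> exists2 J, J \in E & P \in <<J>> :^: W.
Proof.
case/imset2P=> I x; rewrite inE => sIS Wx ->.
have [J EJ /imsetP[y Wy ->]] := conj_representative_exists sIS.
by exists J => //; apply/imsetP; exists (y * x); rewrite ?groupM // genJ conjsgM.
Qed.

(** A Boolean form of [parrow], so that its classes become the components of a finite graph. *)
Definition decomp_arrow (J K : {set gT}) := [&& J \in E, K \in E
  & [exists w in W, (cl <[w]> \in <<J>> :^: W) && (cl <[w.`_p^']> \in <<K>> :^: W)]].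

Lemma decomp_arrowP J K : reflect (parrow W S p E J K) (decomp_arrow J K).
Proof.
apply: (iffP and3P) => [[EJ EK /exists_inP[w Ww /andP[wJ wK]]]|[EJ EK [w [Ww wJ wK]]]].
  by split=> //; exists w.
by split=> //; apply/exists_inP; exists w; rewrite ?wJ.
Qed.

Definition decomp_link : rel {set gT} := [rel J K | decomp_arrow J K || decomp_arrow K J].

Lemma connect_parrow_equiv J K : connect decomp_link J K -> parrow_equiv W S p E J K.
Proof.
case/connectP=> s; elim: s J => [|I s IHs] J /=; first by move=> _ ->; apply: rst_refl.
case/andP=> JI pI defK; apply: rst_trans (IHs I pI defK).
case/orP: JI => /decomp_arrowP; first exact: rst_step.
by move=> IJ; apply/rst_sym/rst_step.
Qed.

Lemma decomp_link_sym : connect_sym decomp_link.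
Proof. by apply: sym_connect_sym => J K; apply: orbC. Qed.

(** The [p]-part of [w] acts on the fixed points of the [p]-regular part, and its fixed points there
    are those of [w]. *)
Lemma parrow_mark_congr (J K I : {set gT}) : I \subset S -> parrow W S p E J K ->
  mark W I J = mark W I K %[mod p].
Proof.
move=> sIS [EJ EK [w [Ww wJ wK]]].
rewrite (mark_closure sIS Ww wJ) (mark_closure sIS _ wK) ?groupX //.
set X := rcosets <<I>> W; pose Y := 'Fix_(X | 'Rs)[w.`_p^'].
have actsX : [acts W, on X | 'Rs] := actsRs_rcosets <<I>>%G W.
have cpp' : commute w.`_p w.`_p^'.
  by apply: (centsP (cycle_abelian w)); apply: cycle_constt.
have actsY : [acts <[w.`_p]>, on Y | 'Rs].
  rewrite cycle_subG !inE /=; apply/subsetP => B; rewrite !inE !sub1set !inE.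
  case/andP=> XB /eqP fB; rewrite (acts_act actsX) ?groupX // XB /=.
  by rewrite -!actM cpp' actM fB eqxx.
rewrite (pgroup_fix_mod (p_elt_constt p w) actsY) afix_cycle.
congr (#|pred_of_set _| %% p)%N; apply/setP => B.
rewrite !inE !sub1set !inE -andbA; congr (_ && _).
apply/eqP/andP=> [fB|[/eqP f1 /eqP f2]]; last by rewrite -(consttC p w) cpp' actM f1 f2.
have fX x : x \in <[w]> -> 'Rs%act B x == B.
  have : B \in 'Fix_('Rs)(<[w]>) by rewrite afix_cycle; apply/afix1P.
  by move/afixP=> fixB /fixB/eqP.
by rewrite !fX ?cycle_constt.
Qed.

Lemma parrow_equiv_mark_congr (J K I : {set gT}) : I \subset S -> parrow_equiv W S p E J K ->
  mark W I J = mark W I K %[mod p].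
Proof.
move=> sIS; elim=> {J K} [J K|J|J K _|J K L _ IH1 _ IH2] //.
  exact: parrow_mark_congr.
by rewrite IH1.
Qed.

Hypothesis cox : coxeter_system W S.

Lemma decomposition_classP K L : K \in E -> L \in E ->
  (forall J, J \in E -> mark W J K = mark W J L %[mod p]) -> parrow_equiv W S p E K L.
Proof.
move=> EK EL eqKL; have invol s : s \in S -> #[s] = 2 := @cox_invol _ _ _ cox s.
have [n [rho [al [be [om rb]]]]] := root_basis_exists cox.
have clP w : w \in W -> cl <[w]> \in parabolics W S.
  by move=> Ww; apply: (parabolic_closure_parabolic invol rb); rewrite cycle_subG.
(* Both have an arrow to the type of the [p]-regular part of [w]; this avoids showing that conjugate
   [<<J>>] and [<<J'>>] come from conjugate subsets. *)
have same_type w J J' : w \in W -> J \in E -> J' \in E ->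
    cl <[w]> \in <<J>> :^: W -> cl <[w]> \in <<J'>> :^: W -> connect decomp_link J J'.
  move=> Ww EJ EJ' wJ wJ'.
  have [I EI wI] := parabolic_type (clP _ (groupX _ Ww : w.`_p^' \in W)).
  have arrow H : H \in E -> cl <[w]> \in <<H>> :^: W -> decomp_arrow H I.
    by move=> EH wH; apply/decomp_arrowP; split=> //; exists w.
  apply: (connect_trans (y := I)); apply: connect1; apply/orP.
    by left; apply: arrow.
  by right; apply: arrow.
apply: connect_parrow_equiv.
(* The indicator of the class of [K]; it is good because an arrow joins the types of [w] and of its
   [p]-regular part. *)
pose inC P := [exists J in E, (P \in <<J>> :^: W) && connect decomp_link K J].
have inC_cl w J : w \in W -> J \in E -> cl <[w]> \in <<J>> :^: W ->
    inC (cl <[w]>) = connect decomp_link K J.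
  move=> Ww EJ wJ; apply/exists_inP/idP => [[I EI /andP[wI KI]]|KJ]; last by exists J; rewrite ?wJ.
  exact: connect_trans KI (same_type w I J Ww EI EJ wI wJ).
have good_inC : good S p (fun P => Posz (inC P)).
  apply: good_section => [P x Wx|w Ww].
    congr (Posz (nat_of_bool _)); apply: eq_existsb => J; congr (_ && (_ && _)).
    apply/imsetP/imsetP => [[y Wy defP]|[y Wy ->]].
      by exists (y * x^-1); rewrite ?groupM ?groupV // conjsgM -defP conjsgK.
    by exists (y * x); rewrite ?groupM // conjsgM.
  have [J EJ wJ] := parabolic_type (clP w Ww).
  have Ww' : w.`_p^' \in W by apply: groupX.
  have [I EI wI] := parabolic_type (clP _ Ww').
  rewrite (inC_cl w J) // (inC_cl _ I) //; congr (Posz (nat_of_bool _)).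
  have JI : connect decomp_link J I.
    by apply: connect1; apply/orP; left; apply/decomp_arrowP; split=> //; exists w.
  apply/idP/idP=> KJ; first exact: connect_trans KJ JI.
  by apply: connect_trans KJ _; rewrite decomp_link_sym.
have [sKS sLS] := (conj_representatives_sub EK, conj_representatives_sub EL).
have congKL (J : {set gT}) : J \subset S -> mark W J K = mark W J L %[mod p].
  move=> sJS; have [I EI /imsetP[x Wx ->]] := conj_representative_exists sJS.
  by rewrite !mark_conj //; apply: eqKL.
have := good_congr p_pr invol rb good_inC sKS sLS congKL.
have type_self J : <<J>> \in <<J>> :^: W by apply/imsetP; exists 1; rewrite ?group1 ?conjsg1.
have -> : inC <<K>> by apply/exists_inP; exists K; rewrite // type_self connect0.
(* An element with closure [<<L>>] lets [inC_cl] evaluate the indicator at [L]; were [L] outside the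
   class, [p] would divide 1. *)
have [w Lw wL] := cuspidal_exists invol rb sLS.
have Ww : w \in W by apply: subsetP Lw; apply: genS.
have wL' : cl <[w]> \in <<L>> :^: W by rewrite wL.
rewrite -{1}wL (inC_cl w L) //; case: connect => //.
by rewrite dvdzE /= dvdn1 => /eqP p1; move: p_pr; rewrite p1.
Qed.

End DecompositionClasses.

Theorem theorem9 (gT : finGroupType) (W : {group gT}) (S : {set gT})
    (E : {set {set gT}}) (p : nat) (K L : {set gT}) :
  coxeter_system W S ->
  conj_representatives W S E ->
  prime p ->
  K \in E ->
  L \in nonzero_rows W p E ->
  decomposition_number W p E K L = 1 <-> parrow_equiv W S p E K L.
Proof.
move=> cox repE p_pr EK; rewrite inE => /andP[EL _].
have defW : W = <<S>>%G by apply: val_inj; rewrite /= (cox_gen cox).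
rewrite defW in cox repE *.
rewrite /decomposition_number; split.
  case: forall_inP => // eqKL _; apply: decomposition_classP => // J EJ.
  exact/eqP/eqKL.
move=> KL; case: forall_inP => // -[] J EJ; apply/eqP.
exact: parrow_equiv_mark_congr (conj_representatives_sub repE EJ) KL.
Qed.
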